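(* Let $\mathcal{X}$ be a measurable space, $n\ge 1$, let $X=(X_1,\dots,X_n)$ be a vector of independent $\mathcal{X}$-valued random variables, let $X'=(X_1',\dots,X_n')$ be an independent copy of $X$, and let $f:\mathcal{X}^n\to\mathbb{R}$ be measurable. Let $W=f(X)$ and suppose $\mathbb{E}(W)=0$ and $0<\sigma^2:=\mathbb{E}(W^2)<\infty$. Let $T$ be the random variable, defined in the context, built from $f$, $X$, $X'$. Then $\mathbb{E}(T)=\sigma^2$ and $$\delta_W \le \frac{[\mathrm{Var}(\mathbb{E}(T\mid W))]^{1/2}}{\sigma^2} + \frac{1}{2\sigma^3}\sum_{j=1}^n \mathbb{E}|\Delta_j f(X)|^3 .$$
   Context: Distance to normality: for a real random variable $W$ with finite second moment and $\mathrm{Var}(W)>0$, $\delta_W:=\mathcal{W}(\mu,\nu)$, where $\mu$ is the law of $(W-\mathbb{E}W)/\sqrt{\mathrm{Var}(W)}$, $\nu$ is the standard Gaussian law, and $\mathcal{W}(\mu,\nu)=\sup\{|\int h\,d\mu-\int h\,d\nu| : h:\mathbb{R}\to\mathbb{R} \text{ Lipschitz with constant}\le 1\}$ is the Kantorovich–Wasserstein distance. Notation: $[n]=\{1,\dots,n\}$. For $A\subseteq[n]$, $X^A$ is the random vector with $X^A_i=X_i'$ if $i\in A$ and $X^A_i=X_i$ if $i\notin A$; $X^j:=X^{\{j\}}$. For $j\in[n]$, $\Delta_j f(X):=f(X)-f(X^j)$, and for $j\notin A$, $\Delta_j f(X^A):=f(X^A)-f(X^{A\cup\{j\}})$. For $A\subseteq[n]$,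 $$T_A:=\sum_{j\notin A}\Delta_j f(X)\,\Delta_j f(X^A),\qquad T:=\frac12\sum_{A\subsetneq[n]}\frac{T_A}{\binom{n}{|A|}(n-|A|)}.$$ *)

(* Defs.v *)
From HB Require Import structures.
From mathcomp Require Import all_boot all_order all_algebra.
From mathcomp Require Import all_classical all_reals all_analysis.
From mathcomp Require Import measurable_realfun.

Set Implicit Arguments.
Unset Strict Implicit.
Unset Printing Implicit Defensive.

Import Order.TTheory GRing.Theory Num.Theory.
Import numFieldNormedType.Exports.

Local Open Scope classical_set_scope.
Local Open Scope ring_scope.

Section independence.
Context (R : realType) (dO : measure_display) (Omega : measurableType dO).
Variable P : probability Omega R.

Definition mutually_independent (I : finType) (d : measure_display)
    (S : measurableType d) (Y : I -> Omega -> S) : Prop :=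
  forall (J : {set I}) (B : I -> set S),
    (forall i, i \in J -> measurable (B i)) ->
    P (\bigcap_(i in [set` J]) (Y i @^-1` B i)) =
    (\prod_(i in J) P (Y i @^-1` B i))%E.

Definition independent_rv (d1 d2 : measure_display)
    (S1 : measurableType d1) (S2 : measurableType d2)
    (Y1 : Omega -> S1) (Y2 : Omega -> S2) : Prop :=
  forall (A : set S1) (B : set S2), measurable A -> measurable B ->
    P (Y1 @^-1` A `&` Y2 @^-1` B) = (P (Y1 @^-1` A) * P (Y2 @^-1` B))%E.

Definition independent_copy (d : measure_display) (S : measurableType d)
    (Y Y' : {RV P >-> S}) : Prop :=
  independent_rv Y Y' /\
  forall A : set S, measurable A -> distribution P Y' A = distribution P Y A.

End independence.

Section conditional_expectation.
Context (R : realType) (dO : measure_display) (Omega : measurableType dO).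
Variable P : probability Omega R.

(* [Z] is a version of E(Y | W).  Conditional expectations are determined only
   up to P-null sets, so they are handled through the set of their versions. *)
Definition is_cond_expectation (d : measure_display) (S : measurableType d)
    (Y : Omega -> R) (W : Omega -> S) (Z : Omega -> R) : Prop :=
  [/\ P.-integrable [set: Omega] (EFin \o Z),
      measurable_fun [set: g_sigma_algebra_preimageType W]
        (Z : g_sigma_algebra_preimageType W -> R) &
      forall A : set Omega, g_sigma_algebra_preimage W A ->
        (\int[P]_(x in A) (Z x)%:E = \int[P]_(x in A) (Y x)%:E)%E].

Lemma cond_expectation_exists (d : measure_display) (S : measurableType d)
    (Y : Omega -> R) (W : {RV P >-> S}) :
  P.-integrable [set: Omega] (EFin \o Y) ->
  exists Z, is_cond_expectation Y W Z.
Proof.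
move=> iY.
pose nu0 : {charge set Omega -> \bar R} := induced_charge iY.
pose mu : probability S R := distribution P W.
have [nu nuE] : exists nu : {charge set S -> \bar R},
    forall A, nu A = pushforward nu0 W A.
  have mW : measurable_fun [set: Omega] W by [].
  by unshelve refine (ex_intro _ (pushforward nu0 W : {charge set S -> \bar R}) _).
have numu : nu `<< mu.
  apply/null_content_dominatesP => A mA muA.
  rewrite nuE; apply: null_set_integral => //.
  - by rewrite -[X in measurable X]setTI; exact: (@measurable_funPT _ _ _ _ W).
  - by apply: (measurable_funS measurableT) => //; case/integrableP: (iY).
pose h := Radon_Nikodym nu mu.
have hfin x : h x \is a fin_num by exact: Radon_Nikodym_fin_num.
have ih : mu.-integrable [set: S] h by exact: Radon_Nikodym_integrable.
have [mh ih_lty] := integrableP _ _ _ ih.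
have ihW : P.-integrable [set: Omega] (h \o W).
  apply/integrableP; split; first exact: measurableT_comp.
  move: ih_lty; rewrite ge0_integral_pushforward//.
  exact: measurableT_comp.
pose Z w := fine (h (W w)).
have ZE : EFin \o Z = h \o W by apply/funext => w /=; rewrite fineK.
exists Z; split; first by rewrite ZE.
- move=> _ B mB; rewrite setTI; exists ((fine \o h) @^-1` B); last by rewrite setTI.
  rewrite -[X in measurable X]setTI.
  exact: (measurableT_comp (@fine_measurable R [set: \bar R] measurableT) mh).
- move=> A [B mB <-]; rewrite setTI.
  have -> : (\int[P]_(x in W @^-1` B) (Y x)%:E = nu B)%E by rewrite nuE.
  rewrite (Radon_Nikodym_integral numu mB) integral_pushforward//.
    by apply: eq_integral => w _; rewrite /= fineK.
  apply: integrableS ihW => //.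
  by rewrite -[X in measurable X]setTI; exact: (@measurable_funPT _ _ _ _ W).
Qed.

End conditional_expectation.

Section distance_to_normality.
Variable R : realType.

Definition wasserstein (mu nu : probability (measurableTypeR R) R) : \bar R :=
  ereal_sup [set `| \int[mu]_x (h x)%:E - \int[nu]_x (h x)%:E |%E
            | h in [set h : R -> R | (1 : R).-lipschitz h]].

Context (dO : measure_display) (Omega : measurableType dO).
Variable P : probability Omega R.

(* The library's normal law lives on [measurableTypeR R], i.e. R with its Borel
   sigma-algebra, so the standardized variable is given that codomain. *)
Definition standardize (W : {RV P >-> R}) : Omega -> measurableTypeR R :=
  fun w => (W w - fine 'E_P[W]) / Num.sqrt (fine 'V_P[W]).

Lemma measurable_standardize (W : {RV P >-> R}) :
  measurable_fun [set: Omega] (standardize W).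
Proof.
have mW : measurable_fun [set: Omega] (W \- cst (fine 'E_P[W])) by [].
exact: (measurable_funM mW (measurable_cst (Num.sqrt (fine 'V_P[W]))^-1)).
Qed.

HB.instance Definition _ (W : {RV P >-> R}) :=
  isMeasurableFun.Build _ _ _ _ (standardize W) (measurable_standardize W).

Definition normality_distance (W : {RV P >-> R}) : \bar R :=
  wasserstein (distribution P (standardize W)) (normal_prob (0 : R) 1).

End distance_to_normality.

Section resampling.
Context (R : realType) (S : Type) (n : nat).
Variable f : n.-tuple S -> R.
Implicit Types (A : {set 'I_n}) (j : 'I_n).

Definition resample (x x' : n.-tuple S) A : n.-tuple S :=
  [tuple if i \in A then tnth x' i else tnth x i | i < n].

Definition Delta (x x' : n.-tuple S) j : R := f x - f (resample x x' [set j]%SET).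

(* Only used for j \notin A; it vanishes otherwise. *)
Definition DeltaA (x x' : n.-tuple S) A j : R :=
  f (resample x x' A) - f (resample x x' (j |: A)%SET).

Definition T_ (x x' : n.-tuple S) A : R :=
  \sum_(j < n | j \notin A) Delta x x' j * DeltaA x x' A j.

Definition Tstat (x x' : n.-tuple S) : R :=
  2^-1 * \sum_(A : {set 'I_n} | A \proper [set: 'I_n]%SET)
           T_ x x' A / ('C(n, #|A|)%:R * (n - #|A|)%:R).

End resampling.

(* Main.v *)
Require Import Defs.
From HB Require Import structures.
From mathcomp Require Import all_boot all_order all_algebra.
From mathcomp Require Import all_classical all_reals all_analysis.
From mathcomp Require Import measurable_realfun.
From mathcomp Require Import ring lra.

(** Stein's method with a discrete gradient.  The weights in [Tstat] are those
    of a uniformly random maximal chain of subsets of ['I_n], so the weighted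
    sum of the increments [f (X^A) - f (X^(j |: A))] telescopes to
    [f X - f X'].  Exchanging [X_j] and [X'_j] then turns
    [E (g X * (f X - f X'))], which is the covariance of [g X] and [f X], into
    half the weighted sum of the expectations of
    [Delta_j g X * Delta_j f (X^A)]; for [g = f] this is [E T = sigma ^+ 2].

    Let [phi] solve Stein's equation [phi' x - x * phi x = h x - E (h N)] for a
    1-Lipschitz [h].  Taking [g] to be [phi] of the normalized [f] and expanding
    [Delta_j g] to first order compares [E (W * phi W)] with [E (phi' W * T)];
    the bounds [|phi'| <= 1] and [phi'] 2-Lipschitz give the two error terms.

    These bounds need no differentiability of [h].  If [h] is nondecreasing,
    then [(x * phi x)' <= 0], by comparing the Gaussian tail with [h x] and using
    a lower bound for Mills' ratio.  For [h] 1-Lipschitz both [h + id] and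
    [id - h] are nondecreasing, and [id] has Stein solution [-1]; hence
    [|(x * phi x)'| <= 1], and [phi' = x * phi + h - E (h N)] is 2-Lipschitz. *)

Set Implicit Arguments.
Unset Strict Implicit.
Unset Printing Implicit Defensive.

Import Order.TTheory GRing.Theory Num.Theory.
Import numFieldNormedType.Exports.

Local Open Scope classical_set_scope.
Local Open Scope ring_scope.

(** * Gaussian tails and Mills' ratio *)

Section std_normal.
Context {R : realType}.
Local Notation mu := (@lebesgue_measure R).
Local Notation p := (@normal_pdf R 0 1).

Lemma std_normal_pdfE x : p x = normal_peak 1 * expR (- (x ^+ 2 / 2)).
Proof.
by rewrite normal_pdfE ?oner_neq0// /normal_fun subr0 expr1n mulNr.
Qed.

Lemma std_normal_pdf_gt0 x : 0 < p x.
Proof. by rewrite std_normal_pdfE mulr_gt0 ?expR_gt0 ?normal_peak_gt0 ?oner_neq0. Qed.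

Lemma std_normal_pdfN x : p (- x) = p x.
Proof. by rewrite !std_normal_pdfE sqrrN. Qed.

Lemma is_derive_std_normal_pdf (x : R) : is_derive x 1 p (- x * p x).
Proof.
have -> : p = (fun y => normal_peak 1 * expR (- (y ^+ 2 / 2))).
  by apply/funext => y; rewrite std_normal_pdfE.
apply: is_derive_eq.
rewrite /GRing.scale/=.
by field.
Qed.

Lemma is_derive_std_normal_pdf1 (x : R) (f : R -> R) (df : R) :
   is_derive x 1 f df -> is_derive x 1 (fun t => f t * p t) ((df - x * f x) * p x).
Proof.
move=> fx; have := is_derive_std_normal_pdf x => px.
apply: is_derive_eq; rewrite /GRing.scale/=; ring.
Qed.

Lemma std_normal_pdf_le x : 0 < x -> x * p x <= normal_peak 1 * 2 / x.
Proof.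
move=> x0; rewrite std_normal_pdfE mulrCA -mulrA ler_wpM2l ?normal_peak_ge0//.
rewrite expRN ler_pdivrMr ?expR_gt0// mulrAC ler_pdivlMr//.
have := expR_ge1Dx (x ^+ 2 / 2); rewrite expr2; lra.
Qed.

Lemma cvg_mulr_std_normal_pdf : x * p x @[x --> +oo] --> (0 : R).
Proof.
have h : normal_peak 1 * 2 / x @[x --> +oo] --> (0 : R).
  rewrite -(mulr0 (normal_peak 1 * 2)); apply: cvgM; first exact: cvg_cst.
  apply/(gtr0_cvgV0 (f := idfun)); last exact: cvg_id.
  exact: nbhs_pinfty_gt.
apply: (squeeze_cvgr _ (cvg_cst 0) h); near=> x.
have x0 : 0 < x by near: x; exact: nbhs_pinfty_gt.
by rewrite std_normal_pdf_le// mulr_ge0 ?ltW ?std_normal_pdf_gt0.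
Unshelve. all: by end_near. Qed.

Lemma cvg_std_normal_pdf : p x @[x --> +oo] --> (0 : R).
Proof.
apply: (squeeze_cvgr _ (cvg_cst 0) cvg_mulr_std_normal_pdf); near=> x.
have x1 : 1 <= x by near: x; exact: nbhs_pinfty_ge.
by rewrite ltW ?std_normal_pdf_gt0//= ler_peMl// ltW// std_normal_pdf_gt0.
Unshelve. all: by end_near. Qed.

Lemma continuous_std_normal_pdf : continuous p.
Proof. by apply: continuous_normal_pdf; rewrite oner_neq0. Qed.

End std_normal.

(** * Gaussian-weighted integrals over half-lines *)

Section gauss_tails.
Context {R : realType}.
Local Notation mu := (@lebesgue_measure R).
Local Notation p := (@normal_pdf R 0 1).

(** The Gaussian weight sits in the integrand, against Lebesgue measure, so that the fundamental
    theorem of calculus applies; [integral_normal_prob] passes to the normal law. *)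
Definition gauss_integrable (g : R -> R) :=
  mu.-integrable setT (EFin \o (fun t => g t * p t)).

Definition gauss_mean (g : R -> R) := \int[mu]_t (g t * p t).
Definition gauss_lower (g : R -> R) x := \int[mu]_(t in `]-oo, x]) (g t * p t).
Definition gauss_upper (g : R -> R) x := \int[mu]_(t in `[x, +oo[) (g t * p t).

Lemma gauss_lower_upper g x : gauss_integrable g ->
  gauss_lower g x + gauss_upper g x = gauss_mean g.
Proof.
move=> ig; rewrite /gauss_lower /gauss_upper /gauss_mean.
rewrite -Rintegral_itv_obnd_cbnd; last exact: integrableS ig.
rewrite -Rintegral_setU//.
- by rewrite -eq_opE itv_setU_setT.
- by apply: integrableS ig => //; exact: measurableU.
- apply/disj_setPS => y [/=]; rewrite 2!in_itv/= => yx /andP[].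
  by rewrite ltNge yx.
Qed.

Lemma is_derive_gauss_lower g (x : R) : continuous g -> gauss_integrable g ->
  is_derive x 1 (gauss_lower g) (g x * p x).
Proof.
move=> cg ig.
have xx1 : x < x + 1 by rewrite ltrDl.
have igx : mu.-integrable `]-oo, x + 1] (EFin \o (fun t => g t * p t)).
  exact: integrableS ig.
have cgx : {for x, continuous (fun t => g t * p t)}.
  by apply: cvgM; [exact: cg|exact: continuous_std_normal_pdf].
have [d] := continuous_FTC1 xx1 igx (ltNyr _) cgx.
by rewrite derive1E => <-; exact/derivableP.
Qed.

Lemma gauss_integrableD g h : gauss_integrable g -> gauss_integrable h ->
  gauss_integrable (fun t => g t + h t).
Proof.
move=> ig ih; apply: eq_integrable (integrableD measurableT ig ih) => // t _.
by rewrite /= mulrDl.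
Qed.

Lemma gauss_integrableZ k g : gauss_integrable g ->
  gauss_integrable (fun t => k * g t).
Proof.
move=> ig; apply: eq_integrable (integrableZl measurableT k ig) => // t _.
by rewrite /= -mulrA.
Qed.

Lemma le_gauss_integrable g h : continuous g -> gauss_integrable h ->
  (forall t, `|g t| <= h t) -> gauss_integrable g.
Proof.
move=> cg ih gh; apply: (le_integrable _ _ _ ih) => //.
  apply/measurable_EFinP; apply: continuous_measurable_fun => t.
  by apply: cvgM; [exact: cg|exact: continuous_std_normal_pdf].
move=> t _ /=; rewrite lee_fin !normrM ler_wpM2r//.
exact: le_trans (gh t) (ler_norm _).
Qed.

Lemma gauss_integrable1 : gauss_integrable (fun=> 1).
Proof.
rewrite /gauss_integrable (_ : _ \o _ = fun t => (p t)%:E).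
  exact: integrable_normal_pdf.
by apply/funext => t /=; rewrite mul1r.
Qed.

Lemma gauss_mean1 : gauss_mean (fun=> 1) = 1.
Proof.
rewrite /gauss_mean /Rintegral.
under eq_integral do rewrite mul1r.
by rewrite integral_normal_pdf.
Qed.

(** The tail integrals below are computed by exhibiting an antiderivative that vanishes at
    infinity. *)
Lemma integral_tail_FTC (f F : R -> R) a :
  (forall x, a <= x -> 0 <= f x) -> continuous f ->
  (forall x : R, is_derive x 1 F (f x)) -> F x @[x --> +oo] --> (0 : R) ->
  (\int[mu]_(x in `[a, +oo[) (f x)%:E = (- F a)%:E)%E.
Proof.
move=> f0 cf dF F0.
have derF (x : R) : derivable F x 1 by have [] := dF x.
rewrite (@ge0_continuous_FTC2y R f F a 0)//.
- by rewrite EFinN sub0e.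
- exact: continuous_subspaceT.
- apply: cvg_at_right_filter; apply/differentiable_continuous.
  exact/derivable1_diffP.
- by move=> x _; rewrite derive1E; exact: derive_val.
Qed.

Lemma gauss_integral_even (g : R -> R) : (forall t, 0 <= g t) ->
  continuous g -> (forall t, g (- t) = g t) ->
  (\int[mu]_t (g t * p t)%:E =
   2%:E * \int[mu]_(t in `[0%R, +oo[) (g t * p t)%:E)%E.
Proof.
move=> g0 cg gN; rewrite ge0_symfun_integralT; first by rewrite -set_itvcy.
- by move=> t; rewrite mulr_ge0// ltW// std_normal_pdf_gt0.
- by move=> t; apply: cvgM; [exact: cg|exact: continuous_std_normal_pdf].
- by move=> t; rewrite /= gN std_normal_pdfN.
Qed.

(** The integrand is nonnegative and even, so a finite value on the half-line yields integrability
    and the mean together. *)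
Lemma gauss_integrable_even (g : R -> R) (r : R) : (forall t, 0 <= g t) ->
  continuous g -> (forall t, g (- t) = g t) ->
  (\int[mu]_(t in `[0%R, +oo[) (g t * p t)%:E)%E = r%:E ->
  gauss_integrable g /\ gauss_mean g = 2 * r.
Proof.
move=> g0 cg gN gr; have e := gauss_integral_even g0 cg gN.
split; last by rewrite /gauss_mean /Rintegral e gr.
apply/integrableP; split.
  apply/measurable_EFinP; apply: continuous_measurable_fun => t.
  by apply: cvgM; [exact: cg|exact: continuous_std_normal_pdf].
under eq_integral => t _.
  rewrite /= ger0_norm; last by rewrite mulr_ge0// ltW// std_normal_pdf_gt0.
  over.
by rewrite e gr ltry.
Qed.

Let integral_tail_id a : 0 <= a ->
  (\int[mu]_(t in `[a, +oo[) (t * p t)%:E)%E = (p a)%:E.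
Proof.
move=> a0; rewrite -[in RHS](opprK (p a)).
apply: (@integral_tail_FTC _ (fun x => - p x)).
- move=> x /(le_trans a0) x0.
  by rewrite mulr_ge0// ltW// std_normal_pdf_gt0.
- by move=> x; apply: cvgM; [exact: cvg_id|exact: continuous_std_normal_pdf].
- move=> x; have dp := is_derive_std_normal_pdf x.
  by apply: is_derive_eq; ring.
- by have := cvgN (@cvg_std_normal_pdf R); rewrite oppr0; apply.
Qed.

Lemma gauss_upper_id a : 0 <= a -> gauss_upper id a = p a.
Proof. by move=> a0; rewrite /gauss_upper /Rintegral integral_tail_id. Qed.

Lemma gauss_integrable_norm : gauss_integrable (fun t => `|t|).
Proof.
apply: (proj1 (@gauss_integrable_even _ (p 0) _ _ _ _)) => //.
- exact: norm_continuous.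
- by move=> t; rewrite normrN.
- rewrite -integral_tail_id//; apply: eq_integral => t.
  by rewrite inE/= in_itv/= andbT => t0; rewrite ger0_norm.
Qed.

Lemma gauss_integrable_id : gauss_integrable id.
Proof.
by apply: le_gauss_integrable gauss_integrable_norm _ => // t; exact: cvg_id.
Qed.

(** On the tail [a <= t], and the tail integral of [t * p t] is [p a]. *)
Lemma gauss_upper1_le a : 0 <= a -> a * gauss_upper (fun=> 1) a <= p a.
Proof.
move=> a0; rewrite -gauss_upper_id// /gauss_upper -RintegralZl//; last first.
  by apply: integrableS gauss_integrable1.
apply: le_Rintegral => //.
- have := integrableZl measurableT a gauss_integrable1.
  by apply: integrableS.
- by apply: integrableS gauss_integrable_id.
- move=> t; rewrite /= in_itv/= andbT => at_; rewrite mul1r ler_wpM2r//.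
  by rewrite ltW// std_normal_pdf_gt0.
Qed.

Lemma is_derive_gauss_upper1 (x : R) :
  is_derive x 1 (gauss_upper (fun=> 1)) (- p x).
Proof.
have -> : gauss_upper (fun=> 1) = (fun y => 1 - gauss_lower (fun=> 1) y).
  apply/funext => y; have := gauss_lower_upper y gauss_integrable1.
  by rewrite gauss_mean1; lra.
have dl : is_derive x 1 (gauss_lower (fun=> 1)) (1 * p x).
  by apply: is_derive_gauss_lower; [move=> y; exact: cvg_cst|exact: gauss_integrable1].
by apply: is_derive_eq; ring.
Qed.

Lemma gauss_upper1_ge0 (x : R) : 0 <= gauss_upper (fun=> 1) x.
Proof.
by apply: Rintegral_ge0 => t _; rewrite mul1r ltW ?std_normal_pdf_gt0.
Qed.

Lemma cvg_gauss_upper1 : gauss_upper (fun=> 1) x @[x --> +oo] --> (0 : R).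
Proof.
apply: (squeeze_cvgr _ (cvg_cst 0) cvg_std_normal_pdf); near=> x.
have x1 : 1 <= x by near: x; exact: nbhs_pinfty_ge.
have x0 : 0 <= x by rewrite (le_trans _ x1).
rewrite gauss_upper1_ge0/= (le_trans _ (gauss_upper1_le x0))//.
by rewrite ler_peMl// gauss_upper1_ge0.
Unshelve. all: by end_near. Qed.

(** With [Q] the Gaussian tail, [- (t * p t) - Q t] is an antiderivative of [t ^+ 2 * p t]. The
    half-line integral is therefore [Q 0], which by symmetry is half of the total mass. *)
Lemma gauss_second_moment :
  gauss_integrable (fun t => t ^+ 2) /\ gauss_mean (fun t => t ^+ 2) = 1.
Proof.
pose Q0 : R := gauss_upper (fun=> 1) 0.
have Q0E : 1 = 2 * Q0.
  rewrite -[LHS]gauss_mean1 /gauss_mean /Rintegral.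
  have c1 : continuous (fun _ : R => 1 : R) by move=> y; exact: cvg_cst.
  rewrite gauss_integral_even// /Q0 /gauss_upper /Rintegral fineM//.
  apply: integrable_fin_num => //.
  by apply: integrableS gauss_integrable1.
rewrite [X in _ /\ _ = X]Q0E; apply: gauss_integrable_even.
- by move=> t; rewrite sqr_ge0.
- by move=> t; exact: exprn_continuous.
- by move=> t; rewrite sqrrN.
rewrite (_ : Q0 = - (- (0 * p 0) - Q0)); last by rewrite mul0r oppr0 sub0r opprK.
apply: (@integral_tail_FTC _ (fun x => - (x * p x) - gauss_upper (fun=> 1) x)).
- by move=> x _; rewrite mulr_ge0 ?sqr_ge0// ltW// std_normal_pdf_gt0.
- move=> x; apply: cvgM; first exact: exprn_continuous.
  exact: continuous_std_normal_pdf.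
- move=> x; have dp := is_derive_std_normal_pdf x.
  have dQ := is_derive_gauss_upper1 x.
  by apply: is_derive_eq; rewrite /GRing.scale/=; ring.
- have := cvgB (cvgN (@cvg_mulr_std_normal_pdf R)) cvg_gauss_upper1.
  by rewrite oppr0 addr0; apply.
Qed.

End gauss_tails.

(** * Lower bound for Mills' ratio *)

Section mills.
Context {R : realType}.
Local Notation mu := (@lebesgue_measure R).
Local Notation p := (@normal_pdf R 0 1).

(* Birnbaum's lower bound for Mills' ratio, see [gauss_upper1_ge]. *)
Definition mills (x : R) := (Num.sqrt (x ^+ 2 + 4) - x) / 2.

(** [mills x] is the positive root of [r ^+ 2 + x * r = 1]. Later identities in [mills x] hold
    modulo this equation: a multiple of [mills x * (mills x + x) - 1] is added so that [ring] or
    [field] can close them. *)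
Lemma mills_spec x : mills x * (mills x + x) = 1.
Proof.
rewrite /mills; set q := Num.sqrt _.
have q2 : q ^+ 2 = x ^+ 2 + 4 by rewrite sqr_sqrtr ?addr_ge0 ?sqr_ge0.
transitivity ((q ^+ 2 - x ^+ 2) / 4); first by field.
by rewrite q2; field.
Qed.

Lemma mills_gt0 x : 0 < mills x.
Proof.
rewrite /mills divr_gt0// subr_gt0 (le_lt_trans (ler_norm x))//.
by rewrite -sqrtr_sqr ltr_sqrt ?ltrDl// ltr_wpDl ?sqr_ge0.
Qed.

Lemma mills_sqrt x : Num.sqrt (x ^+ 2 + 4) = 2 * mills x + x.
Proof. by rewrite /mills; field. Qed.

(** The value is what implicit differentiation of [r * (r + x) = 1] gives:
    [r' * (2 * r + x) + r = 0]. *)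
Lemma is_derive_mills (x : R) :
  is_derive x 1 mills (- mills x / (2 * mills x + x)).
Proof.
have x4 : 0 < x ^+ 2 + 4 by rewrite ltr_wpDl ?sqr_ge0.
have ds := is_derive1_sqrt x4.
have dg : is_derive x 1 (fun x : R => x ^+ 2 + 4) (2 * x).
  by apply: is_derive_eq; rewrite /GRing.scale/=; ring.
have dc : is_derive x 1 (fun x : R => Num.sqrt (x ^+ 2 + 4)) _ :=
  @is_derive1_comp R Num.sqrt (fun x => x ^+ 2 + 4) x _ _ ds dg.
rewrite /mills.
apply: is_derive_eq.
rewrite -mills_sqrt /mills.
have : Num.sqrt (x ^+ 2 + 4) != 0 by rewrite gt_eqF// sqrtr_gt0.
move: (Num.sqrt _) => q q0.
rewrite /GRing.scale/=; field.
by [].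
Qed.

Lemma continuous_mills : continuous mills.
Proof.
move=> x; apply: differentiable_continuous; apply/derivable1_diffP.
by have [] := is_derive_mills x.
Qed.

Lemma mills_le1 x : 0 <= x -> mills x <= 1.
Proof. have := mills_spec x; have := mills_gt0 x; nra. Qed.

(* Both sides vanish at infinity, and the derivative of the left one minus the
   right one is [r ^+ 3 / (2 * r + x) * p x >= 0], where [r := mills x]
   satisfies [r * (r + x) = 1]. *)
Lemma gauss_upper1_ge a : 0 <= a ->
  mills a * p a <= gauss_upper (fun=> 1) a.
Proof.
move=> a0.
pose f x := mills x ^+ 3 / (2 * mills x + x) * p x.
have q0 x : 0 < 2 * mills x + x.
  by rewrite -mills_sqrt sqrtr_gt0 ltr_wpDl ?sqr_ge0.
have f0 x : 0 <= f x.
  by rewrite mulr_ge0// ?divr_ge0 ?exprn_ge0// ltW ?mills_gt0 ?std_normal_pdf_gt0.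
pose F x := mills x * p x - gauss_upper (fun=> 1) x.
suff e : (\int[mu]_(x in `[a, +oo[) (f x)%:E = (- F a)%:E)%E.
  by rewrite -subr_ge0 -opprB -lee_fin -e integral_ge0// => x _; rewrite lee_fin.
apply: integral_tail_FTC.
- by [].
- move=> x; apply: cvgM; last exact: continuous_std_normal_pdf.
  apply: cvgM.
    apply: (@continuous_comp _ _ _ mills (fun y : R => y ^+ 3)).
      exact: continuous_mills.
    exact: exprn_continuous.
  apply: cvgV; first by rewrite gt_eqF.
  apply: cvgD; last exact: cvg_id.
  by apply: cvgM; [exact: cvg_cst|exact: continuous_mills].
- move=> x; have dp := is_derive_std_normal_pdf1 (is_derive_mills x).
  have dQ := is_derive_gauss_upper1 x.
  apply: is_derive_eq; rewrite /f.
  have r1 := mills_spec x.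
  have -> : mills x ^+ 3 / (2 * mills x + x) =
     (- mills x / (2 * mills x + x) - x * mills x) + 1 +
     (mills x * (mills x + x) - 1) * (1 - mills x / (2 * mills x + x)).
    by field; rewrite gt_eqF.
  rewrite r1; ring.
- have h : mills x * p x @[x --> +oo] --> (0 : R).
    apply: (squeeze_cvgr _ (cvg_cst 0) cvg_std_normal_pdf); near=> x.
    have x0 : 0 <= x by near: x; exact: nbhs_pinfty_ge.
    have p0 := std_normal_pdf_gt0 x.
    by rewrite mulr_ge0 ?(ltW (mills_gt0 x)) ?(ltW p0)//= ler_piMl ?(ltW p0)// mills_le1.
  have := cvgB h cvg_gauss_upper1.
  by rewrite subr0; apply.
Unshelve. all: by end_near. Qed.

End mills.

(** * Stein's equation *)

Section reflection.
Context {R : realType}.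
Local Notation mu := (@lebesgue_measure R).
Local Notation p := (@normal_pdf R 0 1).

(** Lebesgue measure is its own image under negation. This settles nonnegative integrands, and the
    general case follows from positive and negative parts. *)
Lemma integral_lebesgueN (D : set R) (f : R -> \bar R) : measurable D ->
  measurable_fun setT f ->
  (\int[mu]_(x in -%R @^-1` D) f (- x)%R = \int[mu]_(x in D) f x)%E.
Proof.
move=> mD mf.
have ge0 (h : R -> \bar R) : measurable_fun setT h -> (forall x, 0 <= h x)%E ->
    (\int[mu]_(x in -%R @^-1` D) h (- x)%R = \int[mu]_(x in D) h x)%E.
  move=> mh h0.
  have := @ge0_integral_pushforward _ _ (measurableTypeR R) (measurableTypeR R) R
    -%R (@oppr_measurable R setT) mu D h mD.
  move=> <-//; last exact: measurable_funS mh.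
  by apply: eq_measure_integral => A mA _; exact: lebesgue_measureN.
rewrite [LHS]integralE [RHS]integralE.
rewrite -(ge0 f^\+%E)//; last exact: measurable_funepos.
rewrite -(ge0 f^\-%E)//; last exact: measurable_funeneg.
by congr (_ - _)%E; apply: eq_integral => x _; rewrite ?funeposE ?funenegE.
Qed.

Lemma gauss_lowerN (g : R -> R) x : measurable_fun setT g ->
  gauss_lower (fun t => g (- t)) x = gauss_upper g (- x).
Proof.
move=> mg; rewrite /gauss_lower /gauss_upper /Rintegral.
rewrite -[in RHS]integral_lebesgueN//.
  rewrite opp_preimage_itvbndy/= opprK; congr fine.
  by apply: eq_integral => t _; rewrite std_normal_pdfN.
apply/measurable_EFinP; apply: measurable_funM => //.
exact: measurable_normal_pdf.
Qed.

Lemma gauss_meanN (g : R -> R) : measurable_fun setT g ->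
  gauss_mean (fun t => g (- t)) = gauss_mean g.
Proof.
move=> mg; rewrite /gauss_mean /Rintegral.
rewrite -[in RHS]integral_lebesgueN//.
  by congr fine; apply: eq_integral => t _; rewrite std_normal_pdfN.
apply/measurable_EFinP; apply: measurable_funM => //.
exact: measurable_normal_pdf.
Qed.

Lemma gauss_integrableN (g : R -> R) : gauss_integrable g ->
  gauss_integrable (fun t => g (- t)).
Proof.
move=> /integrableP[mg ig]; apply/integrableP; split.
  have : measurable_fun setT ((EFin \o (fun t : R => g t * p t)) \o -%R).
    by apply: measurableT_comp => //; exact: oppr_measurable.
  by apply: eq_measurable_fun => t _; rewrite /= std_normal_pdfN.
apply: le_lt_trans ig.
rewrite -[leRHS]integral_lebesgueN//; last exact: measurableT_comp.
by rewrite preimage_setT; under [leRHS]eq_integral do rewrite /= std_normal_pdfN.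
Qed.

End reflection.

(** * Stein's equation for nondecreasing functions *)

Section stein_monotone.
Context {R : realType}.
Local Notation mu := (@lebesgue_measure R).
Local Notation p := (@normal_pdf R 0 1).

(** This makes the factor [1 + x ^+ 2] times the Mills bound exceed [x] by a nonnegative cube, as
    [stein_monotone_ge0] requires. *)
Lemma mills_cube (x : R) : (1 + x ^+ 2) * mills x = x + mills x ^+ 3.
Proof.
transitivity (x * (mills x * (mills x + x)) + mills x ^+ 3 -
  (mills x * (mills x + x) - 1) * mills x); first by ring.
rewrite mills_spec; ring.
Qed.

Variable g : R -> R.
Hypotheses (ndg : {homo g : x y / x <= y}) (ig : gauss_integrable g).
Hypothesis g0 : gauss_mean g = 0.

Let p_gt0 := @std_normal_pdf_gt0 R.

Let lowerE x : gauss_lower g x = - gauss_upper g x.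
Proof. by apply/eqP; rewrite -addr_eq0 gauss_lower_upper// g0. Qed.

Let le_upper x : g x * gauss_upper (fun=> 1) x <= gauss_upper g x.
Proof.
rewrite /gauss_upper -RintegralZl//; last exact: integrableS gauss_integrable1.
apply: le_Rintegral => //.
- have := integrableZl measurableT (g x) gauss_integrable1.
  by apply: integrableS.
- exact: integrableS ig.
- move=> t; rewrite /= in_itv/= andbT => xt.
  by rewrite mul1r ler_wpM2r ?(ltW (p_gt0 _))// ndg.
Qed.

(** If [g x <= 0], then [g <= 0] on the whole lower half-line. Otherwise [g] is positive on the
    upper one, and the two integrals are opposite because the mean vanishes. *)
Lemma gauss_lower_le0 x : gauss_lower g x <= 0.
Proof.
have [gx|gx] := leP (g x) 0.
  rewrite -oppr_ge0 /gauss_lower -mulN1r -RintegralZl//; last exact: integrableS ig.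
  apply: Rintegral_ge0 => t; rewrite /= in_itv/= => tx.
  by rewrite mulN1r oppr_ge0 pmulr_lle0// (le_trans (ndg tx)).
rewrite lowerE oppr_le0 (le_trans _ (le_upper x))// mulr_ge0 ?(ltW gx)//.
exact: gauss_upper1_ge0.
Qed.

(** For [phi = gauss_lower g / p], which solves [phi' - x * phi = g], the left-hand side is [p x]
    times the derivative of [x * phi x]. If [g x <= 0], both terms are nonpositive. Otherwise
    [gauss_lower g x] is minus the upper integral, which is at least [g x] times the Gaussian tail,
    and Mills' bound with [mills_cube] concludes. *)
Lemma stein_monotone_ge0 x : 0 <= x ->
  (1 + x ^+ 2) * gauss_lower g x + x * (g x * p x) <= 0.
Proof.
move=> x0; have F0 := gauss_lower_le0 x; have px := p_gt0 x.
have [gx|gx] := leP (g x) 0.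
  have x1 : 0 <= 1 + x ^+ 2 by rewrite addr_ge0 ?sqr_ge0.
  have h1 := mulr_ge0_le0 x1 F0.
  have h2 := mulr_ge0_le0 x0 (mulr_le0_ge0 gx (ltW px)).
  by rewrite -[leRHS](addr0 0) lerD.
have up := le_upper x; have lo := gauss_upper1_ge x0.
have : (1 + x ^+ 2) * (g x * (mills x * p x)) <= (1 + x ^+ 2) * gauss_upper g x.
  rewrite ler_wpM2l ?addr_ge0 ?sqr_ge0//.
  by apply: le_trans up; rewrite ler_wpM2l// ltW.
rewrite (_ : _ * (_ * _) = g x * p x * ((1 + x ^+ 2) * mills x)); last by ring.
rewrite mills_cube lowerE => h.
have : 0 <= g x * p x * mills x ^+ 3.
  by rewrite mulr_ge0 ?exprn_ge0 ?(ltW (mills_gt0 x))// mulr_ge0 ?(ltW gx) ?(ltW px).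
move: h; lra.
Qed.

End stein_monotone.

Section stein_monotone_all.
Context {R : realType}.
Local Notation p := (@normal_pdf R 0 1).

(** For negative [x], the half-line case is applied at [- x] to [t |-> - g (- t)], which is again
    nondecreasing with mean zero. *)
Lemma stein_monotone (g : R -> R) x : {homo g : x y / x <= y} ->
  gauss_integrable g -> gauss_mean g = 0 ->
  (1 + x ^+ 2) * gauss_lower g x + x * (g x * p x) <= 0.
Proof.
move=> ndg ig g0.
have [x0|x0] := leP 0 x; first exact: stein_monotone_ge0.
have mg : measurable_fun setT g by exact: nondecreasing_measurable.
have mNg : measurable_fun setT (fun t => - g t) by exact: measurableT_comp.
have := @stein_monotone_ge0 R (fun t => - g (- t)) _ _ _ (- x).
rewrite (@gauss_lowerN R (fun t => - g t))// opprK sqrrN std_normal_pdfN.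
have iNg : gauss_integrable (fun t => - g t).
  by have := gauss_integrableZ (-1) ig; under eq_fun do rewrite mulN1r.
have NE A : measurable A ->
  \int[@lebesgue_measure R]_(t in A) (- g t * p t) =
  - \int[@lebesgue_measure R]_(t in A) (g t * p t).
  move=> mA; rewrite -mulN1r -RintegralZl//; last exact: integrableS ig.
  by apply: eq_Rintegral => t _; ring.
have -> : gauss_upper (fun t => - g t) x = gauss_lower g x.
  by rewrite /gauss_upper NE//; have := gauss_lower_upper x ig; rewrite g0 /gauss_upper; lra.
rewrite !mulNr mulrN opprK; apply.
- by move=> a b ab; rewrite lerN2 ndg// lerN2.
- exact: (@gauss_integrableN R (fun t => - g t)).
- by rewrite (@gauss_meanN R (fun t => - g t))// /gauss_mean NE// -/(gauss_mean g) g0 oppr0.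
- by rewrite oppr_ge0 ltW.
Qed.

End stein_monotone_all.

(** * Mean value and Taylor estimates *)

Section mean_value.
Context {R : realType}.

(** The sign condition says that [c] lies on the same side of [x] as [y], whatever the order of [x]
    and [y]. *)
Lemma MVT_between (f df : R -> R) (x y : R) :
  (forall z : R, is_derive z 1 f (df z)) ->
  exists2 c, 0 <= (c - x) * (y - x) & f y - f x = df c * (y - x).
Proof.
move=> dff.
have wc (a b : R) : {within `[a, b], continuous f}.
  apply: derivable_within_continuous => z _.
  by have [] := dff z.
have [xy|yx] := leP x y.
  have [c + cE] := MVT_segment xy (fun z _ => dff z) (wc _ _).
  rewrite in_itv/= => /andP[xc _]; exists c => //.
  by rewrite mulr_ge0 ?subr_ge0.
have [c + cE] := MVT_segment (ltW yx) (fun z _ => dff z) (wc _ _).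
rewrite in_itv/= => /andP[_ cx]; exists c; first by rewrite mulr_le0 ?subr_le0 ?(ltW yx).
by rewrite -(opprB (f x)) cE -mulrN opprB.
Qed.

Lemma derive_le1_lipschitz (f df : R -> R) (x y : R) :
  (forall z : R, is_derive z 1 f (df z)) -> (forall z, `|df z| <= 1) ->
  `|f x - f y| <= `|x - y|.
Proof.
move=> dff df1; have [c _ ->] := MVT_between y x dff.
by rewrite normrM ler_piMl.
Qed.

Lemma taylor1_lipschitz (f df : R -> R) (L x y : R) :
  (forall z : R, is_derive z 1 f (df z)) ->
  (forall a b, `|df a - df b| <= L * `|a - b|) ->
  `|f y - f x - df x * (y - x)| <= L / 2 * (y - x) ^+ 2.
Proof.
move=> dff Ldf.
have upper (g dg : R -> R) : (forall z : R, is_derive z 1 g (dg z)) ->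
    (forall a b, `|dg a - dg b| <= L * `|a - b|) ->
    g y - g x - dg x * (y - x) <= L / 2 * (y - x) ^+ 2.
  move=> dgg Ldg.
  (* The derivative of [k] has sign opposite to that of [z - x], because [dg] is [L]-Lipschitz;
     hence [k y <= k x]. *)
  pose k z := g z - dg x * (z - x) - L / 2 * (z - x) ^+ 2.
  have dk (z : R) : is_derive z 1 k (dg z - dg x - L * (z - x)).
    have := dgg z => dgz; rewrite /k.
    by apply: is_derive_eq; rewrite /GRing.scale/=; field.
  have [c cxy] := MVT_between x y dk.
  have : (dg c - dg x - L * (c - x)) * (y - x) <= 0.
    have := Ldg c x; rewrite ler_norml => /andP[h1 h2].
    have [xy|yx|->] := ltgtP x y; last by rewrite subrr mulr0.
    - move: cxy; rewrite pmulr_lge0 ?subr_gt0// => cx.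
      rewrite pmulr_lle0 ?subr_gt0//; move: h2; rewrite ger0_norm//; lra.
    - move: cxy; rewrite nmulr_lge0 ?subr_lt0// => cx.
      rewrite nmulr_lle0 ?subr_lt0//; move: h1; rewrite ler0_norm//; lra.
  move=> h kE; move: h; rewrite -kE /k subrr; lra.
rewrite ler_norml upper// andbT.
have dN (z : R) : is_derive z 1 (fun z => - f z) (- df z).
  by have := dff z => dfz; apply: is_derive_eq.
have /(upper _ _ dN) : forall a b, `|- df a - - df b| <= L * `|a - b|.
  by move=> a b; rewrite -opprD normrN.
lra.
Qed.

End mean_value.

(** * The Stein solution of a Lipschitz function *)

Section stein_solution.
Context {R : realType}.
Local Notation mu := (@lebesgue_measure R).
Local Notation p := (@normal_pdf R 0 1).

Lemma gauss_RintegralD D (g h : R -> R) : measurable D ->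
  gauss_integrable g -> gauss_integrable h ->
  \int[mu]_(t in D) ((g t + h t) * p t) =
  \int[mu]_(t in D) (g t * p t) + \int[mu]_(t in D) (h t * p t).
Proof.
move=> mD ig ih; rewrite -RintegralD//; try exact: integrableS ig;
  try exact: integrableS ih.
by apply: eq_Rintegral => t _; rewrite mulrDl.
Qed.

Lemma gauss_RintegralZ D (g : R -> R) k : measurable D ->
  gauss_integrable g ->
  \int[mu]_(t in D) (k * g t * p t) = k * \int[mu]_(t in D) (g t * p t).
Proof.
move=> mD ig; rewrite -RintegralZl//; try exact: integrableS ig.
by apply: eq_Rintegral => t _; rewrite mulrA.
Qed.

Lemma gauss_mean_id : gauss_mean (@id R) = 0.
Proof.
have mid : measurable_fun setT (@id R) by exact: measurable_id.
have := gauss_meanN mid.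
rewrite /gauss_mean; under eq_Rintegral do rewrite -mulN1r.
rewrite gauss_RintegralZ//; last exact: gauss_integrable_id.
lra.
Qed.

Lemma gauss_lower_id (x : R) : gauss_lower id x = - p x.
Proof.
have iid := @gauss_integrable_id R.
have [x0|x0] := leP 0 x.
  have := gauss_lower_upper x iid.
  by rewrite gauss_mean_id gauss_upper_id//; lra.
have mid : measurable_fun setT (@id R) by exact: measurable_id.
have := gauss_lowerN x mid.
rewrite gauss_upper_id ?oppr_ge0 ?(ltW x0)// std_normal_pdfN => <-.
rewrite /gauss_lower; under [in RHS]eq_Rintegral do rewrite -mulN1r.
by rewrite gauss_RintegralZ// mulN1r opprK.
Qed.

Lemma le_gauss_mean (g h : R -> R) : gauss_integrable g -> gauss_integrable h ->
  (forall t, g t <= h t) -> gauss_mean g <= gauss_mean h.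
Proof.
move=> ig ih gh; apply: le_Rintegral => // t _.
by rewrite ler_wpM2r// ltW// std_normal_pdf_gt0.
Qed.

Lemma le_normr_gauss_mean (g : R -> R) : gauss_integrable g ->
  `|gauss_mean g| <= gauss_mean (fun t => `|g t|).
Proof.
move=> ig; apply: le_trans (le_normr_Rintegral _ ig) _ => //.
rewrite le_eqVlt; apply/orP; left; apply/eqP/eq_Rintegral => t _.
by rewrite normrM (ger0_norm (ltW (std_normal_pdf_gt0 t))).
Qed.

(** Since [p' = - x * p], the density is an integrating factor: Stein's equation reads
    [(phi * p)' = (h - E h(N)) * p], and this is the solution obtained by integrating from minus
    infinity. *)
Definition stein_sol (h : R -> R) x :=
  gauss_lower (fun t => h t - gauss_mean h) x / p x.

(** The derivative as read off from Stein's equation, which thereby holds by definition;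
    [is_derive_stein_sol] proves that it is the derivative. *)
Definition stein_der (h : R -> R) x := h x - gauss_mean h + x * stein_sol h x.

Variable h : R -> R.
Hypothesis lip : forall x y, `|h x - h y| <= `|x - y|.

Let p_gt0 := @std_normal_pdf_gt0 R.

Lemma lip_continuous : continuous h.
Proof.
move=> x; apply/cvgrPdist_le => /= e e0; near=> y.
apply: le_trans (lip x y) _; near: y.
by exists e => //= y; rewrite /ball/= => /ltW.
Unshelve. all: by end_near. Qed.

Lemma gauss_integrable_lip : gauss_integrable h.
Proof.
have i1 := gauss_integrableZ (`|h 0|) (@gauss_integrable1 R).
apply: le_gauss_integrable lip_continuous (gauss_integrableD i1 gauss_integrable_norm) _.
move=> t; have := lip t 0; rewrite subr0 mulr1 => ht.
by rewrite -[h t](subrK (h 0)) (le_trans (ler_normD _ _))// addrC lerD2l.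
Qed.

Let g t := h t - gauss_mean h.

Let glip x y : `|g x - g y| <= `|x - y|.
Proof. by rewrite /g opprB addrA subrK lip. Qed.

Let cg : continuous g.
Proof. by move=> x; apply: cvgB; [exact: lip_continuous|exact: cvg_cst]. Qed.

Let ig : gauss_integrable g.
Proof.
have := gauss_integrableD gauss_integrable_lip
  (gauss_integrableZ (- gauss_mean h) (@gauss_integrable1 R)).
by under eq_fun do rewrite mulr1.
Qed.

Let g0 : gauss_mean g = 0.
Proof.
rewrite /gauss_mean /g.
have i1 := gauss_integrableZ (- gauss_mean h) (@gauss_integrable1 R).
under eq_Rintegral do rewrite -[- gauss_mean h]mulr1.
rewrite (gauss_RintegralD measurableT gauss_integrable_lip i1).
rewrite (gauss_RintegralZ _ measurableT gauss_integrable1).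
by rewrite -/(gauss_mean h) -/(gauss_mean (fun=> 1)) gauss_mean1; ring.
Qed.

(** As [g] has mean zero, [|g x| <= E |x - N|], and [E (x - N) ^+ 2 = 1 + x ^+ 2]. *)
Lemma stein_centered_bound x : `|g x| <= Num.sqrt (1 + x ^+ 2).
Proof.
set s := Num.sqrt _.
have s2 : s ^+ 2 = 1 + x ^+ 2 by rewrite sqr_sqrtr// addr_ge0 ?sqr_ge0.
have s0 : 0 < s by rewrite sqrtr_gt0 ltr_pwDl ?sqr_ge0.
have [i2 m2] := @gauss_second_moment R.
have i1 := @gauss_integrable1 R.
have gxE : g x = gauss_mean (fun t => g x + -1 * g t).
  rewrite /gauss_mean; under eq_Rintegral do rewrite -[g x]mulr1.
  rewrite (gauss_RintegralD measurableT (gauss_integrableZ _ i1) (gauss_integrableZ _ ig)).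
  rewrite (gauss_RintegralZ _ measurableT i1) (gauss_RintegralZ _ measurableT ig).
  by rewrite -/(gauss_mean g) -/(gauss_mean (fun=> 1)) gauss_mean1 g0; ring.
have igx : gauss_integrable (fun t => g x + -1 * g t).
  have := gauss_integrableD (gauss_integrableZ (g x) i1) (gauss_integrableZ (-1) ig).
  by under eq_fun do rewrite mulr1.
(* [q t] is [((x - t) ^+ 2 / s + s) / 2] expanded in moments. It dominates [|x - t|] by the
   arithmetic-geometric mean inequality, and its mean is [s], so it replaces Cauchy-Schwarz. *)
pose q t := (2 * s)^-1 * t ^+ 2 + ((- x / s) * t + (x ^+ 2 / (2 * s) + s / 2) * 1).
have ii := @gauss_integrable_id R.
have iq1 := gauss_integrableD (gauss_integrableZ (- x / s) ii)
  (gauss_integrableZ (x ^+ 2 / (2 * s) + s / 2) i1).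
have iq : gauss_integrable q := gauss_integrableD (gauss_integrableZ _ i2) iq1.
have -> : s = gauss_mean q.
  rewrite /gauss_mean /q (gauss_RintegralD measurableT (gauss_integrableZ _ i2) iq1).
  rewrite (gauss_RintegralD measurableT (gauss_integrableZ _ ii) (gauss_integrableZ _ i1)).
  rewrite (gauss_RintegralZ _ measurableT i2) (gauss_RintegralZ _ measurableT ii).
  rewrite (gauss_RintegralZ _ measurableT i1).
  rewrite -/(gauss_mean (fun t => t ^+ 2)) -/(gauss_mean id) -/(gauss_mean (fun=> 1)).
  rewrite m2 gauss_mean_id gauss_mean1.
  transitivity ((1 + x ^+ 2) / (2 * s) + s / 2); last by field; rewrite gt_eqF.
  by rewrite -s2; field; rewrite gt_eqF.
rewrite gxE; apply: le_trans (le_normr_gauss_mean igx) _.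
apply: le_gauss_mean => //.
  by have := integrable_norm igx; apply: eq_integrable => // t _ /=;
    rewrite normrM (ger0_norm (ltW (p_gt0 t))).
move=> t; rewrite mulN1r (le_trans (glip x t))// /q.
rewrite -subr_ge0 (_ : _ - _ = (`|x - t| - s) ^+ 2 / (2 * s)).
  by rewrite divr_ge0 ?sqr_ge0// mulr_ge0// ltW.
rewrite sqrrB real_normK ?num_real//.
by field; rewrite gt_eqF.
Qed.


(** This is [|(x * phi x)'| <= 1] multiplied by [p x], for the Stein solution [phi]. The upper bound
    uses [g], the lower one [- g]. *)
Lemma stein_weighted_bound x :
  `|(1 + x ^+ 2) * gauss_lower g x + x * (g x * p x)| <= p x.
Proof.
have ii := @gauss_integrable_id R.
(* Monotone comparison applied to the nondecreasing function [k + id], whose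
   Stein solution is the one of [k] minus [1]. *)
have up (k : R -> R) : (forall x y, `|k x - k y| <= `|x - y|) ->
    gauss_integrable k -> gauss_mean k = 0 ->
    (1 + x ^+ 2) * gauss_lower k x + x * (k x * p x) <= p x.
  move=> klip ik k0.
  have := @stein_monotone R (fun t => k t + t) x.
  have -> : gauss_lower (fun t => k t + t) x = gauss_lower k x - p x.
    by rewrite -gauss_lower_id; apply: gauss_RintegralD.
  have -> : gauss_mean (fun t => k t + t) = 0.
    transitivity (gauss_mean k + gauss_mean id); first exact: gauss_RintegralD.
    by rewrite k0 gauss_mean_id addr0.
  move=> H; have {H} := H _ (gauss_integrableD ik ii) erefl.
  move=> H; rewrite -subr_ge0 -oppr_le0; apply: le_trans (H _); last first.
    move=> a b ab; have := klip a b; rewrite ler_norml ler0_norm ?subr_le0//; lra.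
  by rewrite le_eqVlt; apply/orP; left; apply/eqP; ring.
rewrite ler_norml up// andbT.
have := up (fun t => -1 * g t).
have -> : gauss_lower (fun t => -1 * g t) x = - gauss_lower g x.
  by rewrite -[RHS]mulN1r; exact: gauss_RintegralZ.
have -> : gauss_mean (fun t => -1 * g t) = 0.
  transitivity (-1 * gauss_mean g); last by rewrite g0 mulr0.
  exact: gauss_RintegralZ.
move=> H; have {H} := H _ (gauss_integrableZ _ ig) erefl.
move=> H; rewrite lerNl; apply: le_trans (H _); last first.
  by move=> a b; rewrite !mulN1r -opprD normrN.
by rewrite le_eqVlt; apply/orP; left; apply/eqP; ring.
Qed.

Lemma is_derive_stein_sol (x : R) : is_derive x 1 (stein_sol h) (stein_der h x).
Proof.
have dF := is_derive_gauss_lower x cg ig.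
have dp := is_derive_std_normal_pdf x.
have pn0 : p x != 0 by rewrite gt_eqF.
have dV := is_deriveV pn0 dp.
rewrite /stein_sol; apply: is_derive_eq.
rewrite /stein_der /stein_sol /GRing.scale/= -/(g x).
by field.
Qed.

(** Up to a constant, [stein_der h] is the sum of two 1-Lipschitz functions, [h] and
    [x * stein_sol h x]. *)
Lemma stein_der_lipschitz x y : `|stein_der h x - stein_der h y| <= 2 * `|x - y|.
Proof.
have d (z : R) : is_derive z 1 (fun z => z * stein_sol h z)
  (stein_sol h z + z * stein_der h z).
  have dz := is_derive_stein_sol z.
  by apply: is_derive_eq; rewrite /GRing.scale/=; ring.
have b z : `|stein_sol h z + z * stein_der h z| <= 1.
  have := stein_weighted_bound z.
  have pz := p_gt0 z.
  rewrite -[leRHS]mul1r -ler_pdivrMr// -[X in _ / X](gtr0_norm pz) -normf_div.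
  apply: le_trans; rewrite le_eqVlt; apply/orP; left; apply/eqP; congr `| _ |.
  rewrite /stein_der /stein_sol -/(g z).
  by field; rewrite gt_eqF.
have := derive_le1_lipschitz x y d b.
have := lip x y.
rewrite !ler_norml => /andP[h1 h2] /andP[h3 h4].
rewrite /stein_der; apply/andP; split; lra.
Qed.

Lemma stein_taylor x y :
  `|stein_sol h y - stein_sol h x - stein_der h x * (y - x)| <= (y - x) ^+ 2.
Proof.
have := taylor1_lipschitz x y is_derive_stein_sol stein_der_lipschitz.
by rewrite divff// mul1r.
Qed.

End stein_solution.

(** * Uniform bound on the derivative of the Stein solution *)

Section stein_der_bound.
Context {R : realType}.
Local Notation mu := (@lebesgue_measure R).
Local Notation p := (@normal_pdf R 0 1).

(** Because [mills x + x] is the inverse of [mills x], the claim amounts to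
    [x + s <= (mills x + x) ^+ 2]. Both sides are compared with [1 + x + x ^+ 2 / 2]. *)
Lemma mills_sqr_le1 (x : R) : 0 <= x ->
  (x + Num.sqrt (1 + x ^+ 2)) * mills x ^+ 2 <= 1.
Proof.
move=> x0; set s := Num.sqrt _.
have s2 : s ^+ 2 = 1 + x ^+ 2 by rewrite sqr_sqrtr// addr_ge0 ?sqr_ge0.
have r0 := mills_gt0 x; have r1 := mills_spec x.
have sle : s <= 1 + x ^+ 2 / 2 by have := sqr_ge0 (s - 1); rewrite sqrrB s2; lra.
have r2 : 1 <= mills x + x / 2.
  have r20 : 0 <= mills x + x / 2 by lra.
  rewrite -(@ler_pXn2r _ 2) ?nnegrE//.
  rewrite expr1n (_ : _ ^+ 2 = mills x * (mills x + x) + x ^+ 2 / 4); last by field.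
  by rewrite r1 lerDl divr_ge0 ?sqr_ge0.
have xs : x + s <= (mills x + x) ^+ 2.
  rewrite (_ : _ ^+ 2 = mills x * (mills x + x) + x * (mills x + x / 2) + x ^+ 2 / 2);
    last by field.
  have := ler_wpM2l x0 r2; rewrite r1; lra.
apply: le_trans (_ : (mills x + x) ^+ 2 * mills x ^+ 2 <= 1).
  by rewrite ler_wpM2r ?sqr_ge0.
by rewrite -exprMn mulrC r1 expr1n.
Qed.

(** With [Q] the Gaussian tail at [x], [stein_der h x * p x] equals [(h x - c) * (p x - x * Q)]
    minus [x] times the tail integral of [h - h x]. The first factor is at most [sqrt (1 + x ^+ 2)],
    and the tail integral at most that of [t - x], which is [p x - x * Q]. Mills' bound gives
    [p x - x * Q <= p x * mills x ^+ 2], and [mills_sqr_le1] concludes. *)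
Lemma stein_der_le1_ge0 (h : R -> R) x :
  (forall x y, `|h x - h y| <= `|x - y|) -> 0 <= x -> `|stein_der h x| <= 1.
Proof.
move=> lip x0.
have px := std_normal_pdf_gt0 x.
have ih := gauss_integrable_lip lip.
have i1 := @gauss_integrable1 R.
have ii := @gauss_integrable_id R.
have bg := stein_centered_bound lip x.
set c := gauss_mean h in bg *.
set Q := gauss_upper (fun=> 1 : R) x.
have upE (a b : R) (k : R -> R) : gauss_integrable k ->
    gauss_upper (fun t => a * k t + b * 1) x = a * gauss_upper k x + b * Q.
  move=> ik; rewrite /Q /gauss_upper.
  by rewrite (gauss_RintegralD _ (gauss_integrableZ a ik) (gauss_integrableZ b i1))//
    !gauss_RintegralZ.
have iab (a b : R) (k : R -> R) : gauss_integrable k ->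
    gauss_integrable (fun t => a * k t + b * 1).
  by move=> ik; apply: gauss_integrableD; exact: gauss_integrableZ.
have idE : gauss_upper (fun t => 1 * t + - x * 1) x = p x - x * Q.
  by rewrite (upE 1 (- x) id)// gauss_upper_id// mul1r mulNr.
have hE : `|gauss_upper h x - h x * Q| <= p x - x * Q.
  have -> : gauss_upper h x - h x * Q = gauss_upper (fun t => 1 * h t + - h x * 1) x.
    by rewrite upE// mul1r mulNr.
  rewrite -idE /gauss_upper.
  apply: le_trans (le_normr_Rintegral _ _) _ => //.
    by apply: integrableS (iab 1 (- h x) h ih).
  apply: le_Rintegral => //.
  - apply: integrable_norm.
    by apply: integrableS (iab 1 (- h x) h ih).
  - by apply: integrableS (iab 1 (- x) id ii).
  - move=> t; rewrite /= in_itv/= andbT => xt.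
    rewrite normrM (gtr0_norm (std_normal_pdf_gt0 t)).
    rewrite ler_wpM2r ?(ltW (std_normal_pdf_gt0 t))//.
    rewrite !mulr1 !mul1r (le_trans (lip _ _))// ger0_norm ?subr_ge0//.
have FE : gauss_lower (fun t => h t - c) x = - (gauss_upper h x - c * Q).
  have ihc : gauss_integrable (fun t => 1 * h t + - c * 1) by exact: iab.
  have hcE : (fun t => 1 * h t + - c * 1) = (fun t => h t - c).
    by apply/funext => t; rewrite mul1r mulr1.
  have := gauss_lower_upper x ihc; rewrite upE// {1}hcE.
  have -> : gauss_mean (fun t => 1 * h t + - c * 1) = 0.
    rewrite /gauss_mean.
    rewrite (gauss_RintegralD measurableT (gauss_integrableZ _ ih) (gauss_integrableZ _ i1)).
    rewrite (gauss_RintegralZ _ measurableT ih) (gauss_RintegralZ _ measurableT i1).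
    rewrite -/(gauss_mean (fun=> 1)) -/(gauss_mean h) gauss_mean1 -/c; ring.
  lra.
have Qlo := gauss_upper1_ge x0; rewrite -/Q in Qlo.
have xQ := gauss_upper1_le x0; rewrite -/Q in xQ.
have r1 := mills_spec x.
have pQ : p x - x * Q <= p x * mills x ^+ 2.
  have -> : p x * mills x ^+ 2 =
    p x - x * (mills x * p x) + (mills x * (mills x + x) - 1) * p x by ring.
  rewrite r1; have := ler_wpM2l x0 Qlo; lra.
have cs := mills_sqr_le1 x0.
rewrite -(ler_pM2r px) mul1r -[X in _ * X](gtr0_norm px) -normrM.
have -> : stein_der h x * p x =
    (h x - c) * (p x - x * Q) - x * (gauss_upper h x - h x * Q).
  rewrite /stein_der /stein_sol -/c FE; field; by rewrite gt_eqF.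
apply: (@le_trans _ _ ((Num.sqrt (1 + x ^+ 2) + x) * (p x - x * Q))).
  apply: le_trans (ler_normB _ _) _; rewrite !normrM mulrDl.
  rewrite (ger0_norm x0) lerD ?ler_wpM2l//.
  by rewrite [`|p x - _|]ger0_norm ?ler_wpM2r// subr_ge0.
apply: (@le_trans _ _ ((Num.sqrt (1 + x ^+ 2) + x) * (p x * mills x ^+ 2))).
  by rewrite ler_wpM2l// addr_ge0 ?sqrtr_ge0.
by rewrite mulrCA -[leRHS]mulr1 ler_wpM2l ?(ltW px)// addrC.
Qed.

(** Reflecting [h] turns the solution [phi x] into [- phi (- x)], because the lower and upper
    integrals of a centered function are opposite. This carries the bound to negative [x]. *)
Lemma stein_derN (h : R -> R) x : (forall x y, `|h x - h y| <= `|x - y|) ->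
  stein_der (fun t => h (- t)) (- x) = stein_der h x.
Proof.
move=> lip; have ih := gauss_integrable_lip lip.
have mh : measurable_fun setT h.
  by apply: continuous_measurable_fun; exact: lip_continuous.
rewrite /stein_der /stein_sol gauss_meanN// opprK std_normal_pdfN.
set c := gauss_mean h.
have mhc : measurable_fun setT (fun t => h t - c) by exact: measurable_funB.
rewrite (gauss_lowerN _ mhc) opprK.
have ihc : gauss_integrable (fun t => h t - c).
  have := gauss_integrableD ih (gauss_integrableZ (- c) (@gauss_integrable1 R)).
  by under eq_fun do rewrite mulr1.
have := gauss_lower_upper x ihc.
have -> : gauss_mean (fun t => h t - c) = 0.
  transitivity (gauss_mean h + (- c) * gauss_mean (fun=> 1 : R)).
    rewrite /gauss_mean -(gauss_RintegralZ _ measurableT (@gauss_integrable1 R)).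
    rewrite -(gauss_RintegralD measurableT ih (gauss_integrableZ (- c) (@gauss_integrable1 R))).
    by apply: eq_Rintegral => t _; rewrite mulr1.
  by rewrite gauss_mean1 mulr1 subrr.
move=> /eqP; rewrite addr_eq0 => /eqP ->; ring.
Qed.

Lemma stein_der_le1 (h : R -> R) x :
  (forall x y, `|h x - h y| <= `|x - y|) -> `|stein_der h x| <= 1.
Proof.
move=> lip; have [x0|x0] := leP 0 x; first exact: stein_der_le1_ge0.
rewrite -stein_derN// stein_der_le1_ge0// ?oppr_ge0 ?(ltW x0)// => a b.
by rewrite (le_trans (lip _ _))// -opprD normrN.
Qed.

End stein_der_bound.

(** * Integrals against the normal law *)

Section normal_prob_integral.
Context {R : realType}.
Local Notation mu := (@lebesgue_measure R).
Local Notation p := (@normal_pdf R 0 1).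

(** The Radon-Nikodym derivative of the normal law and the density [p] have the same integral over
    every measurable set, hence agree almost everywhere. *)
Lemma ge0_integral_normal_prob (f : R -> \bar R) :
  measurable_fun setT f -> (forall x, 0 <= f x)%E ->
  (\int[normal_prob 0 1]_x f x = \int[mu]_x (f x * (p x)%:E))%E.
Proof.
move=> mf f0.
have dom : normal_prob (0 : R) 1 `<< mu by exact: normal_prob_dominates.
rewrite -(Radon_Nikodym_SigmaFinite.change_of_variables dom)//.
have iRN := Radon_Nikodym_SigmaFinite.f_integrable dom.
apply: ae_eq_integral => //.
- by apply: emeasurable_funM => //; exact: measurable_int iRN.
- apply: emeasurable_funM => //.
  by apply/measurable_EFinP; exact: measurable_normal_pdf.
- apply: ae_eqe_mul2l; apply: integral_ae_eq => //.
  + by apply/measurable_EFinP; exact: measurable_normal_pdf.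
  + by move=> E _ mE; rewrite -Radon_Nikodym_SigmaFinite.f_integral.
Qed.

Lemma integral_normal_prob (h : R -> R) : measurable_fun setT h ->
  gauss_integrable h ->
  (\int[normal_prob 0 1]_x (h x)%:E = (gauss_mean h)%:E)%E.
Proof.
move=> mh ih.
have mEh : measurable_fun setT (EFin \o h) by exact/measurable_EFinP.
rewrite /gauss_mean /Rintegral fineK; last exact: integrable_fin_num.
rewrite [LHS]integralE [RHS]integralE.
rewrite ge0_integral_normal_prob//; last exact: measurable_funepos.
rewrite ge0_integral_normal_prob//; last exact: measurable_funeneg.
congr (_ - _)%E; apply: eq_integral => x _.
- rewrite !funeposE -!EFin_max -EFinM maxr_pMl ?mul0r//.
  by rewrite ltW// std_normal_pdf_gt0.
- rewrite !funenegE -!EFinN -!EFin_max -EFinM maxr_pMl ?mul0r ?mulNr//.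
  by rewrite ltW// std_normal_pdf_gt0.
Qed.

(* [psi] is the derivative of [phi]. *)
Lemma stein_equation (h : R -> R) : (forall x y, `|h x - h y| <= `|x - y|) ->
  exists phi psi : R -> R,
  [/\ forall x, (\int[normal_prob 0 1]_y (h y)%:E =
        (h x - (psi x - x * phi x))%:E)%E,
      continuous psi,
      forall x, `|psi x| <= 1,
      forall x y, `|phi x - phi y| <= `|x - y| &
      forall x y, `|phi y - phi x - psi x * (y - x)| <= (y - x) ^+ 2].
Proof.
move=> lip; exists (stein_sol h), (stein_der h).
have dphi := is_derive_stein_sol lip.
have psi1 x := stein_der_le1 x lip.
have philip x y := derive_le1_lipschitz x y dphi psi1.
have ch := lip_continuous lip.
split => [x|x|//|//|x y]; last exact: stein_taylor.
- rewrite integral_normal_prob//; last exact: gauss_integrable_lip.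
    by congr EFin; rewrite /stein_der; ring.
  exact: continuous_measurable_fun.
- apply: cvgD; first by apply: cvgB; [exact: ch|exact: cvg_cst].
  by apply: cvgM; [exact: cvg_id|exact: lip_continuous philip x].
Qed.

End normal_prob_integral.

(** * Resampling *)

Section resampling_weights.
Context {R : realFieldType} (n : nat).
Implicit Types (A B : {set 'I_n}) (u : {set 'I_n} -> R).

(** For a proper subset [A], the probability that a uniformly random maximal chain visits [A] and
    then adds a given [j] outside [A]. *)
Definition resampling_weight A : R := ('C(n, #|A|)%:R * (n - #|A|)%:R)^-1.
Local Notation wt := resampling_weight.

Lemma resampling_weight_ge0 A : 0 <= wt A.
Proof. by rewrite invr_ge0 mulr_ge0. Qed.

(** Summing over the steps out of [A] gives the probability that the chain visits [A];
    [resampling_weight_first] does the same for the steps into [B]. *)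
Lemma resampling_weight_last A : A \proper [set: 'I_n]%SET ->
  (n - #|A|)%:R * wt A = 'C(n, #|A|)%:R^-1.
Proof.
move=> /proper_card; rewrite cardsT card_ord => An.
have nA : (n - #|A|)%:R != 0 :> R by rewrite pnatr_eq0 -lt0n subn_gt0.
have cA : 'C(n, #|A|)%:R != 0 :> R by rewrite pnatr_eq0 -lt0n bin_gt0 ltnW.
by rewrite /wt; field; rewrite nA cA.
Qed.

Lemma resampling_weight_first B j : j \in B ->
  #|B|%:R * wt (B :\ j)%SET = 'C(n, #|B|)%:R^-1.
Proof.
move=> jB; have := cardsD1 j B; rewrite jB add1n => cB.
have Bn : (#|B| <= n)%N by rewrite -[X in (_ <= X)%N]card_ord max_card.
rewrite /wt; set k := #|(B :\ j)%SET| in cB *; rewrite cB in Bn *.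
have kn : (n - k)%:R != 0 :> R by rewrite pnatr_eq0 -lt0n subn_gt0.
have ck : 'C(n, k)%:R != 0 :> R by rewrite pnatr_eq0 -lt0n bin_gt0 ltnW.
have ck1 : 'C(n, k.+1)%:R != 0 :> R by rewrite pnatr_eq0 -lt0n bin_gt0.
have e : 'C(n, k)%:R * (n - k)%:R = k.+1%:R * 'C(n, k.+1)%:R :> R.
  by rewrite -!natrM mulnC mul_bin_left.
by rewrite e invfM mulrA divff ?mul1r// pnatr_eq0.
Qed.

(* The weights are those of a uniformly random maximal chain of subsets, along
   which [u] telescopes. *)
Lemma resampling_telescope u :
  \sum_(A : {set 'I_n} | A \proper [set: 'I_n]%SET)
    (\sum_(j | j \notin A) (u A - u (j |: A)%SET)) * wt A = u finset.set0 - u finset.setT.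
Proof.
pose c A := u A / 'C(n, #|A|)%:R.
(* [c A] is [u A] times the probability of visiting [A]. The sums over steps out of and into a set
   are both [\sum_A c A] up to one term: the full set is never left, the empty set never entered. *)
have out : \sum_(A : {set 'I_n} | A \proper [set: 'I_n]%SET) (\sum_(j | j \notin A) u A) * wt A =
    \sum_A c A - u finset.setT.
  rewrite [in RHS](bigD1 finset.setT)//= [c finset.setT]/c cardsT card_ord binn divr1 addrC addrK.
  apply: eq_big => [A|A Ap]; first by rewrite properT.
  rewrite sumr_const (_ : #|_| = (n - #|A|)%N); last first.
    have := cardC (mem A); rewrite [RHS]card_ord => nE.
    by rewrite -[X in (X - _)%N]nE addKn; exact: eq_card.
  by rewrite -mulr_natr -mulrA resampling_weight_last.
have into : \sum_(A : {set 'I_n} | A \proper [set: 'I_n]%SET)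
     (\sum_(j | j \notin A) u (j |: A)%SET) * wt A = \sum_A c A - u finset.set0.
  rewrite [in RHS](bigD1 finset.set0)//= [c finset.set0]/c cards0 bin0 divr1 addrC addrK.
  under eq_bigr do rewrite mulr_suml.
  rewrite (exchange_big_dep predT)//=.
  transitivity (\sum_(j < n) \sum_(B : {set 'I_n} | j \in B) u B * wt (B :\ j)%SET).
    apply: eq_bigr => j _.
    rewrite (reindex_onto (fun B : {set 'I_n} => B :\ j)%SET (fun A => j |: A)%SET) /=; last first.
      by move=> A /andP[_ jA]; rewrite finset.setU1K.
    apply: eq_big => [B|B /andP[_ /eqP ->]//].
    rewrite finset.setD11 andbT; apply/andP/idP => [[_ /eqP <-]|jB]; first by rewrite finset.setU11.
    rewrite finset.setD1K// eqxx properT; split=> //.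
    by apply/eqP => BT; have := finset.setD11 j B; rewrite BT inE.
  rewrite (exchange_big_dep predT)//= (bigID (pred1 finset.set0))/= big_pred1_eq.
  rewrite big_pred0 ?add0r => [|j]; last by rewrite inE.
  apply: eq_bigr => B B0; rewrite /c.
  have [j0 j0B] := finset.set0Pn _ B0.
  have B0' : #|B|%:R != 0 :> R by rewrite pnatr_eq0 cards_eq0.
  transitivity (\sum_(j in B) u B * ('C(n, #|B|)%:R^-1 / #|B|%:R)).
    by apply: eq_bigr => j jB; rewrite -(resampling_weight_first jB) mulrAC divff ?mul1r.
  by rewrite sumr_const -[LHS]mulr_natr -mulrA divfK.
under eq_bigr do rewrite sumrB mulrBl.
by rewrite sumrB out into opprB addrC subrKA.
Qed.

(** Each maximal chain adds [j] exactly once: telescope the indicator of [j \notin A]. *)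
Lemma sum_resampling_weight (j : 'I_n) :
  \sum_(A : {set 'I_n} | (A \proper [set: 'I_n]%SET) && (j \notin A)) wt A = 1.
Proof.
have := resampling_telescope (fun A => (j \notin A)%:R).
rewrite !inE/= mulr1n subr0 => <-; rewrite big_mkcondr; apply: eq_bigr => A _.
have [jA|jA] := ifPn.
  rewrite (bigD1 j)//= finset.setU11/= subr0 big1 ?addr0 ?mul1r// => i /andP[_ ij].
  by rewrite !inE eq_sym (negPf ij) jA subrr.
by rewrite negbK in jA; rewrite big1 ?mul0r// => i _; rewrite !inE jA orbT subrr.
Qed.

End resampling_weights.

(** * Invariance of the joint law under coordinate exchange *)

Section joint_law.
Context (dS : measure_display) (S : measurableType dS) (n : nat).
Local Notation V := (n.-tuple S).
Implicit Types (B C : 'I_n -> set S) (A : {set 'I_n}).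

Definition tuple_box B : set V := [set x | forall i, B i (tnth x i)].

Lemma measurable_tuple_box B : (forall i, measurable (B i)) ->
  measurable (tuple_box B).
Proof.
move=> mB.
have -> : tuple_box B = \bigcap_(i in [set: 'I_n]) ((@tnth n S ^~ i) @^-1` B i).
  by apply/seteqP; split => x /= xB i; [move=> _; exact: xB|exact: xB].
apply: fin_bigcap_measurable => // i _.
by rewrite -[X in measurable X]setTI; exact: measurable_tnth.
Qed.

(** A generating family closed under intersection, on which independence turns the law of [(X, X')]
    into a product; measures are compared on it. *)
Definition box_rect : set (set (V * V)) :=
  [set Z | exists B C, [/\ forall i, measurable (B i), forall i, measurable (C i) &
    Z = tuple_box B `*` tuple_box C]].

Lemma setI_closed_box_rect : setI_closed box_rect.
Proof.
move=> _ _ [B1 [C1 [mB1 mC1 ->]]] [B2 [C2 [mB2 mC2 ->]]].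
exists (fun i => B1 i `&` B2 i), (fun i => C1 i `&` C2 i); split.
- by move=> i; exact: measurableI.
- by move=> i; exact: measurableI.
- apply/seteqP; split => -[x y] /=.
    by move=> [[h1 h2] [h3 h4]]; split => i; split.
  by move=> [h1 h2]; split; split => i; case: (h1 i) (h2 i) => ? ? [].
Qed.

Lemma measurable_box_rect : @measurable _ (V * V)%type = <<s box_rect >>.
Proof.
apply/seteqP; split; last first.
  apply: smallest_sub; first exact: sigma_algebra_measurable.
  by move=> _ [B [C [mB mC ->]]]; apply: measurableX; exact: measurable_tuple_box.
pose T := g_sigma_algebraType box_rect.
have mid : measurable_fun [set: T] (id : T -> (V * V)%type).
  (* A condition on one coordinate is a box with every other side equal to the whole space; [b]
     selects the component of the pair. *)
  have rect (i : 'I_n) (D : set S) (b : bool) : measurable D ->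
      box_rect [set z | D (tnth (if b then z.1 else z.2) i)].
    move=> mD.
    have mk (c : bool) j : measurable (if (j == i) && c then D else setT : set S).
      by case: ifP.
    exists (fun j => if (j == i) && b then D else setT),
      (fun j => if (j == i) && ~~ b then D else setT); split => //.
    apply/seteqP; split => -[x y] /=.
      by case: b mk => _ d; split => j /=; case: ifP => // /andP[/eqP ->].
    by case: b mk => _ [/(_ i) + /(_ i)] /=; rewrite eqxx.
  apply/measurable_fun_pairP; split; apply/measurable_fun_tnthP => i _ D mD;
    rewrite setTI; apply: sub_sigma_algebra.
    exact: (rect i D true).
  exact: (rect i D false).
move=> Z mZ; have := mid measurableT Z mZ.
by rewrite setTI.
Qed.

Section swap.
Context (R : realType) (dO : measure_display) (Omega : measurableType dO).
Variables (P : probability Omega R) (X X' : {RV P >-> V}).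

Lemma measurable_resample A (d : measure_display) (T : measurableType d)
    (Y Y' : T -> V) : measurable_fun setT Y -> measurable_fun setT Y' ->
  measurable_fun setT (fun w => resample (Y w) (Y' w) A).
Proof.
move=> mY mY'; apply/measurable_fun_tnthP => i.
have -> : (@tnth n S ^~ i) \o (fun w => resample (Y w) (Y' w) A) =
    (fun w => if i \in A then tnth (Y' w) i else tnth (Y w) i).
  by apply/funext => w /=; rewrite tnth_mktuple.
by case: (i \in A); [move/measurable_fun_tnthP : mY'|move/measurable_fun_tnthP : mY]; apply.
Qed.

Hypothesis indep : mutually_independent P (fun (i : 'I_n) w => tnth (X w) i).
Hypothesis copy : independent_copy X X'.

Let prob_box B : (forall i, measurable (B i)) ->
  P (X @^-1` tuple_box B) = (\prod_i P ((fun w => tnth (X w) i) @^-1` B i))%E.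
Proof.
move=> mB; have := indep (J := finset.setT) (fun i _ => mB i).
have -> : \bigcap_(i in [set` finset.setT]) ((fun w => tnth (X w) i) @^-1` B i) =
    X @^-1` tuple_box B.
  apply/seteqP; split => w /= h i; first exact: (h i (finset.in_setT _)).
  by move=> _; exact: h.
by move=> ->; apply: eq_bigl => i; rewrite finset.in_setT.
Qed.

(** The product is arranged with one factor per coordinate, symmetric in [B i] and [C i], so
    exchanging them on any set of coordinates leaves it unchanged. *)
Lemma joint_law_box B C : (forall i, measurable (B i)) -> (forall i, measurable (C i)) ->
  P ((fun w => (X w, X' w)) @^-1` (tuple_box B `*` tuple_box C)) =
  (\prod_i (P ((fun w => tnth (X w) i) @^-1` B i) *
            P ((fun w => tnth (X w) i) @^-1` C i)))%E.
Proof.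
move=> mB mC; have [ind law] := copy.
rewrite big_split/= -!prob_box//.
rewrite -[X in (_ * X)%E]/(distribution P X (tuple_box C)) -law; last first.
  exact: measurable_tuple_box.
by apply: ind; exact: measurable_tuple_box.
Qed.

Definition swap_resample A w : V * V :=
  (resample (X w) (X' w) A, resample (X' w) (X w) A).

Lemma measurable_swap_resample A : measurable_fun setT (swap_resample A).
Proof. by apply: measurable_fun_pair; exact: measurable_resample. Qed.

(** The preimage of a box under the exchange is the box whose sides are exchanged on [A], so both
    laws agree on [box_rect]. *)
Lemma joint_law_swap A (Z : set (V * V)) : measurable Z ->
  P (swap_resample A @^-1` Z) = P ((fun w => (X w, X' w)) @^-1` Z).
Proof.
have mXX' : measurable_fun setT (fun w => (X w, X' w)) by exact: measurable_fun_pair.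
pose j1 : {RV P >-> (V * V)%type} := HB.pack (swap_resample A)
  (isMeasurableFun.Build _ _ _ _ _ (measurable_swap_resample A)).
pose j0 : {RV P >-> (V * V)%type} := HB.pack (fun w => (X w, X' w))
  (isMeasurableFun.Build _ _ _ _ _ mXX').
move=> mZ; rewrite -[LHS]/(distribution P j1 Z) -[RHS]/(distribution P j0 Z).
apply: (measure_unique box_rect (fun=> setT)) => //.
- exact: measurable_box_rect.
- exact: setI_closed_box_rect.
- move=> _; exists (fun=> setT), (fun=> setT); split => //.
  by apply/seteqP; split => // z _; split.
- by rewrite bigcup_const//; exists 0%N.
- move=> _ [B [C [mB mC ->]]]; rewrite /distribution /pushforward.
  rewrite -[RHS]/(P ((fun w => (X w, X' w)) @^-1` (tuple_box B `*` tuple_box C))).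
  rewrite -[LHS]/(P (swap_resample A @^-1` (tuple_box B `*` tuple_box C))).
  rewrite joint_law_box//.
  have -> : swap_resample A @^-1` (tuple_box B `*` tuple_box C) = (fun w => (X w, X' w)) @^-1`
      (tuple_box (fun i => if i \in A then C i else B i) `*`
       tuple_box (fun i => if i \in A then B i else C i)).
    apply/seteqP; split => w /= [h1 h2]; split => i; have := h1 i; have := h2 i;
      rewrite /= ?tnth_mktuple; by case: ifP.
  rewrite joint_law_box//; try by move=> i; case: ifP.
  by apply: eq_bigr => i _; case: ifP => // _; rewrite muleC.
- by move=> k; rewrite /= /distribution /pushforward preimage_setT probability_setT ltry.
Qed.

End swap.
End joint_law.

Section integrals.
Context (d : measure_display) (T : measurableType d) (R : realType).
Variable P : {measure set T -> \bar R}.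
Implicit Types Y Z : T -> R.

Lemma le_integrable_EFin Y Z : measurable_fun setT Y ->
  P.-integrable setT (EFin \o Z) -> (forall w, `|Y w| <= Z w) ->
  P.-integrable setT (EFin \o Y).
Proof.
move=> mY iZ YZ; apply: (le_integrable _ _ _ iZ) => //.
  exact/measurable_EFinP.
by move=> w _ /=; rewrite lee_fin (le_trans (YZ w))// ler_norm.
Qed.

Lemma integrable_measurable Y : P.-integrable setT (EFin \o Y) ->
  measurable_fun setT Y.
Proof. by move=> /integrableP[/measurable_EFinP]. Qed.

Lemma Rintegral_sum (I : Type) (r : seq I) (Q : pred I) (F : I -> T -> R) :
  (forall i, P.-integrable setT (EFin \o F i)) ->
  P.-integrable setT (EFin \o (fun w => \sum_(i <- r | Q i) F i w)) /\
  \int[P]_w (\sum_(i <- r | Q i) F i w) = \sum_(i <- r | Q i) \int[P]_w F i w.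
Proof.
move=> iF; elim: r => [|i r [IHi IHe]].
  under eq_fun do rewrite big_nil.
  rewrite big_nil; split; first exact: integrable0.
  by rewrite Rintegral_cst// mul0r.
under eq_fun do rewrite big_cons.
rewrite big_cons; case: ifP => // _; split; first exact: (integrableD measurableT (iF i) IHi).
by rewrite RintegralD// IHe.
Qed.

Definition square_integrable Y :=
  measurable_fun setT Y /\ P.-integrable setT (EFin \o (fun w => Y w ^+ 2)).

Lemma square_integrableM Y Z : square_integrable Y -> square_integrable Z ->
  P.-integrable setT (EFin \o (fun w => Y w * Z w)).
Proof.
move=> [mY iY] [mZ iZ].
apply: (@le_integrable_EFin _ (fun w => Y w ^+ 2 + Z w ^+ 2)).
- exact: measurable_funM.
- exact: (integrableD measurableT iY iZ).
- move=> w; rewrite normrM -(real_normK (num_real (Y w))) -(real_normK (num_real (Z w))).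
  by have := sqr_ge0 (`|Y w| - `|Z w|); have := sqr_ge0 (`|Y w| + `|Z w|); nra.
Qed.

Lemma square_integrableB Y Z : square_integrable Y -> square_integrable Z ->
  square_integrable (fun w => Y w - Z w).
Proof.
move=> sY sZ; have iYZ := square_integrableM sY sZ.
move: sY sZ => [mY iY] [mZ iZ]; split; first exact: measurable_funB.
apply: (@le_integrable_EFin _ (fun w => 2 * (Y w ^+ 2 + Z w ^+ 2))).
- by apply: measurable_funX; exact: measurable_funB.
- exact: (integrableZl measurableT 2 (integrableD measurableT iY iZ)).
- by move=> w; rewrite ger0_norm ?sqr_ge0//; have := sqr_ge0 (Y w + Z w); nra.
Qed.

End integrals.

Section resample.
Context (S : Type) (n : nat).
Implicit Types (x : n.-tuple S) (A B : {set 'I_n}).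

Lemma resample0 x x' : resample x x' finset.set0 = x.
Proof. by apply: eq_from_tnth => i; rewrite tnth_mktuple finset.in_set0. Qed.

Lemma resampleT x x' : resample x x' finset.setT = x'.
Proof. by apply: eq_from_tnth => i; rewrite tnth_mktuple finset.in_setT. Qed.

(** Exchanging a coordinate twice restores it, so sets of exchanged coordinates combine by symmetric
    difference. *)
Lemma resample_resample x x' A B :
  resample (resample x x' A) (resample x' x A) B =
  resample x x' ((A :\: B) :|: (B :\: A))%SET.
Proof.
apply: eq_from_tnth => i; rewrite !tnth_mktuple !finset.inE.
by case: (i \in A); case: (i \in B).
Qed.

Lemma resample_swap1 x x' A (j : 'I_n) : j \notin A ->
  resample (resample x x' [set j]%SET) (resample x' x [set j]%SET) A =
  resample x x' (j |: A)%SET.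
Proof.
move=> jA; rewrite resample_resample; congr resample.
apply/finset.setP => i; rewrite !finset.inE.
by have [->|_] := eqVneq i j; rewrite ?(negPf jA)//=; case: (i \in A).
Qed.

Lemma resample_swapU1 x x' A (j : 'I_n) : j \notin A ->
  resample (resample x x' [set j]%SET) (resample x' x [set j]%SET) (j |: A)%SET =
  resample x x' A.
Proof.
move=> jA; rewrite resample_resample; congr resample.
apply/finset.setP => i; rewrite !finset.inE.
by have [->|_] := eqVneq i j; rewrite ?(negPf jA)//=; case: (i \in A).
Qed.

End resample.

(** * Integrals under coordinate exchange *)

Section swap_integral.
Context (R : realType) (dS : measure_display) (S : measurableType dS) (n : nat).
Context (dO : measure_display) (Omega : measurableType dO).
Variables (P : probability Omega R) (X X' : {RV P >-> n.-tuple S}).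
Local Notation V := (n.-tuple S).
Hypothesis indep : mutually_independent P (fun (i : 'I_n) w => tnth (X w) i).
Hypothesis copy : independent_copy X X'.
Implicit Types (A : {set 'I_n}) (G : V * V -> \bar R).

Let mjoint : measurable_fun setT (fun w => (X w, X' w)).
Proof. exact: measurable_fun_pair. Qed.

Lemma ge0_integral_swap A G : measurable_fun setT G -> (forall z, 0 <= G z)%E ->
  (\int[P]_w G (swap_resample X X' A w) = \int[P]_w G (X w, X' w))%E.
Proof.
move=> mG G0.
have msw := measurable_swap_resample X X' A.
rewrite -[LHS](ge0_integral_pushforward msw P measurableT mG)//.
rewrite -[RHS](ge0_integral_pushforward mjoint P measurableT mG)//.
by apply: eq_measure_integral => Z mZ _; exact: joint_law_swap.
Qed.

Lemma integral_swap A G : measurable_fun setT G ->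
  (\int[P]_w G (swap_resample X X' A w) = \int[P]_w G (X w, X' w))%E.
Proof.
move=> mG; rewrite [LHS]integralE [RHS]integralE.
have sp := ge0_integral_swap A (measurable_funepos mG) (fun z => funepos_ge0 G z).
have sn := ge0_integral_swap A (measurable_funeneg mG) (fun z => funeneg_ge0 G z).
congr (_ - _)%E.
  transitivity (\int[P]_w (G^\+ (swap_resample X X' A w)))%E; last rewrite sp;
  by apply: eq_integral => w _; rewrite !funeposE.
transitivity (\int[P]_w (G^\- (swap_resample X X' A w)))%E; last rewrite sn;
by apply: eq_integral => w _; rewrite !funenegE.
Qed.

Lemma integrable_swap A (F : V * V -> R) : measurable_fun setT F ->
  P.-integrable setT (EFin \o (fun w => F (X w, X' w))) ->
  P.-integrable setT (EFin \o (fun w => F (swap_resample X X' A w))).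
Proof.
move=> mF /integrableP[_ iF]; apply/integrableP; split.
  by apply/measurable_EFinP; apply: measurableT_comp => //; exact: measurable_swap_resample.
have mG : measurable_fun setT (fun z => `|(F z)%:E|%E).
  by apply: measurableT_comp => //; exact/measurable_EFinP.
by rewrite (ge0_integral_swap A mG).
Qed.

Lemma Rintegral_swap A (F : V * V -> R) : measurable_fun setT F ->
  \int[P]_w F (swap_resample X X' A w) = \int[P]_w F (X w, X' w).
Proof.
move=> mF; rewrite /Rintegral; congr fine.
by apply: (@integral_swap A (EFin \o F)); exact/measurable_EFinP.
Qed.

Lemma square_integrable_resample A (f : V -> R) : measurable_fun setT f ->
  square_integrable P (fun w => f (X w)) ->
  square_integrable P (fun w => f (resample (X w) (X' w) A)).
Proof.
move=> mf [_ iX].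
have m1 : measurable_fun setT (fun z : V * V => f z.1) by exact: measurableT_comp.
split; last by apply: (@integrable_swap A (fun z => f z.1 ^+ 2)) => //; exact: measurable_funX.
by apply: measurableT_comp => //; exact: measurable_resample.
Qed.

(** The law of [(X, X')] is the square of the law of [X], so Fubini gives the inner integral
    [g x * E (f X) = 0]. *)
Lemma integral_mul_copy (g f : V -> R) :
  measurable_fun setT g -> measurable_fun setT f ->
  P.-integrable setT (EFin \o (fun w => g (X w) * f (X' w))) ->
  P.-integrable setT (EFin \o (fun w => f (X w))) ->
  \int[P]_w f (X w) = 0 ->
  \int[P]_w (g (X w) * f (X' w)) = 0.
Proof.
move=> mg mf igf if_ f0.
pose j0 : {RV P >-> (V * V)%type} := HB.pack (fun w => (X w, X' w))
  (isMeasurableFun.Build _ _ _ _ _ mjoint).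
pose mu : probability V R := distribution P X.
pose G (z : V * V) := (g z.1 * f z.2)%:E.
have mG : measurable_fun setT G.
  by apply/measurable_EFinP; apply: measurable_funM; exact: measurableT_comp.
have law Z : measurable Z -> (mu \x mu)%E Z = distribution P j0 Z.
  apply: product_measure_unique => A B mA mB.
  have [ind cp] := copy.
  rewrite /mu -[X in (_ * X)%E]cp//.
  exact: ind.
have iG : (mu \x mu)%E.-integrable setT G.
  apply/integrableP; split=> //.
  rewrite (eq_measure_integral (distribution P j0)) => [|Z mZ _]; last exact: law.
  rewrite ge0_integral_distribution//; last exact: measurableT_comp.
  by case/integrableP : igf.
rewrite /Rintegral; transitivity (fine (\int[mu \x mu]_z G z)%E).
  congr fine; rewrite (eq_measure_integral (distribution P j0)) => [|Z mZ _]; last exact: law.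
  by rewrite integral_distribution.
rewrite -integral12_prod_meas1//.
rewrite (_ : (\int[mu]_x fubini_F mu G x)%E = 0%E)//.
apply: integral0_eq => x _; rewrite /fubini_F /G /=.
under eq_integral do rewrite EFinM.
rewrite integralZl//; last first.
  by apply: integrable_pushforward => //; exact/measurable_EFinP.
rewrite integral_distribution//; last exact/measurable_EFinP.
have : (\int[P]_w (f (X w))%:E)%E = 0%E.
  by rewrite -[RHS]/(0%:E) -f0 /Rintegral fineK//; exact: integrable_fin_num.
by rewrite /comp => ->; rewrite mule0.
Qed.

End swap_integral.

(** * Covariance as a sum over discrete gradients *)

Section covariance_identity.
Context (R : realType) (dS : measure_display) (S : measurableType dS) (n : nat).
Context (dO : measure_display) (Omega : measurableType dO).
Variables (P : probability Omega R) (X X' : {RV P >-> n.-tuple S}).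
Local Notation V := (n.-tuple S).
Hypothesis indep : mutually_independent P (fun (i : 'I_n) w => tnth (X w) i).
Hypothesis copy : independent_copy X X'.
Local Notation wt := (@resampling_weight R n).

(* Polarization of [Tstat]: [cov_stat f f] is [Tstat f]. *)
Definition cov_stat (g f : V -> R) (x x' : V) : R :=
  2^-1 * \sum_(A : {set 'I_n} | A \proper [set: 'I_n]%SET)
    (\sum_(j < n | j \notin A) Delta g x x' j * DeltaA f x x' A j) /
    ('C(n, #|A|)%:R * (n - #|A|)%:R).

Variables g f : V -> R.
Hypotheses (mg : measurable_fun setT g) (mf : measurable_fun setT f).
Hypotheses (sg : square_integrable P (fun w => g (X w))).
Hypotheses (sf : square_integrable P (fun w => f (X w))).

Lemma square_integrable_Delta j :
  square_integrable P (fun w => Delta g (X w) (X' w) j).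
Proof. by apply: square_integrableB => //; exact: square_integrable_resample. Qed.

Lemma square_integrable_DeltaA A j :
  square_integrable P (fun w => DeltaA f (X w) (X' w) A j).
Proof. by apply: square_integrableB => //; exact: square_integrable_resample. Qed.

Lemma integrable_Delta_DeltaA A j : P.-integrable setT
  (EFin \o (fun w => Delta g (X w) (X' w) j * DeltaA f (X w) (X' w) A j)).
Proof.
exact: square_integrableM (square_integrable_Delta j) (square_integrable_DeltaA A j).
Qed.

(** Exchanging [X_j] and [X'_j] turns [g (X^j)] into [g X] and changes the sign of [DeltaA], so the
    two halves of [Delta g] contribute equally. *)
Lemma integral_Delta_DeltaA (A : {set 'I_n}) (j : 'I_n) : j \notin A ->
  \int[P]_w (Delta g (X w) (X' w) j * DeltaA f (X w) (X' w) A j) =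
  2 * \int[P]_w (g (X w) * DeltaA f (X w) (X' w) A j).
Proof.
move=> jA.
have sD := square_integrable_DeltaA A j.
have sgj := square_integrable_resample indep copy [set j]%SET mg sg.
have i1 := square_integrableM sg sD.
have i2 := square_integrableM sgj sD.
transitivity (\int[P]_w (g (X w) * DeltaA f (X w) (X' w) A j -
  g (resample (X w) (X' w) [set j]%SET) * DeltaA f (X w) (X' w) A j)).
  by apply: eq_Rintegral => w _; rewrite /Delta mulrBl.
rewrite RintegralB// mulr_natl mulr2n; congr (_ + _).
pose F (z : V * V) := g z.1 * DeltaA f z.1 z.2 A j.
have mF : measurable_fun setT F.
  apply: measurable_funM; first exact: measurableT_comp.
  by apply: measurable_funB; apply: measurableT_comp => //;
    apply: measurable_resample.
rewrite -[RHS](Rintegral_swap indep copy [set j]%SET mF).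
rewrite -mulN1r -RintegralZl//; apply: eq_Rintegral => w _.
by rewrite /F /swap_resample /DeltaA/= resample_swap1// resample_swapU1//; ring.
Qed.

Lemma integral_cov_stat : \int[P]_w f (X w) = 0 ->
  P.-integrable setT (EFin \o (fun w => cov_stat g f (X w) (X' w))) /\
  \int[P]_w cov_stat g f (X w) (X' w) = \int[P]_w (g (X w) * f (X w)).
Proof.
move=> f0.
have igf := square_integrableM sg sf.
have sf' : square_integrable P (fun w => f (X' w)).
  have := square_integrable_resample indep copy finset.setT mf sf.
  by under eq_fun do rewrite resampleT.
have igf' := square_integrableM sg sf'.
have if_ : P.-integrable setT (EFin \o (fun w => f (X w))).
  have s1 : square_integrable P (fun=> 1).
    split => //; rewrite (_ : _ \o _ = cst 1%E); last first.
      by apply/funext => w /=; rewrite expr1n.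
    exact: finite_measure_integrable_cst.
  by have := square_integrableM s1 sf; under eq_fun do rewrite mul1r.
pose h (A : {set 'I_n}) j w := if j \notin A then
  Delta g (X w) (X' w) j * DeltaA f (X w) (X' w) A j else 0.
have ih (A : {set 'I_n}) j : P.-integrable setT (EFin \o (h A j)).
  rewrite /h; case: (j \notin A); first exact: integrable_Delta_DeltaA.
  exact: integrable0.
pose k (A : {set 'I_n}) j w := g (X w) * DeltaA f (X w) (X' w) A j.
have ik (A : {set 'I_n}) j : P.-integrable setT (EFin \o (k A j)).
  by apply: square_integrableM => //; exact: square_integrable_DeltaA.
have hk (A : {set 'I_n}) (j : 'I_n) : j \notin A -> \int[P]_w h A j w = 2 * \int[P]_w k A j w.
  by move=> jA; rewrite -integral_Delta_DeltaA// /h jA.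
have [] := @Rintegral_sum _ _ _ P _ (index_enum {set 'I_n})
  (fun A => A \proper [set: 'I_n]%SET)
  (fun A w => 2^-1 * wt A * \sum_(j < n | j \notin A) h A j w).
  move=> A; have [iA _] := @Rintegral_sum _ _ _ P _ (index_enum 'I_n)
    (fun j => j \notin A) (fun j => h A j) (ih A).
  exact: (integrableZl measurableT (2^-1 * wt A) iA).
move=> iS eS.
have cE w : cov_stat g f (X w) (X' w) =
   \sum_(A : {set 'I_n} | A \proper [set: 'I_n]%SET)
     2^-1 * wt A * \sum_(j < n | j \notin A) h A j w.
  rewrite /cov_stat mulr_sumr; apply: eq_bigr => A _.
  rewrite -mulrA; congr (_ * _); rewrite mulrC; congr (_ * _).
  by apply: eq_bigr => j jA; rewrite /h jA.
split; first by under eq_fun do rewrite cE.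
under eq_Rintegral do rewrite cE.
rewrite eS.
have [] := @Rintegral_sum _ _ _ P _ (index_enum {set 'I_n})
  (fun A => A \proper [set: 'I_n]%SET)
  (fun A w => wt A * \sum_(j < n | j \notin A) k A j w).
  move=> A; have [iA _] := @Rintegral_sum _ _ _ P _ (index_enum 'I_n)
    (fun j => j \notin A) (fun j => k A j) (ik A).
  exact: (integrableZl measurableT (wt A) iA).
move=> _ eK.
transitivity (\int[P]_w \sum_(A : {set 'I_n} | A \proper [set: 'I_n]%SET)
   wt A * \sum_(j < n | j \notin A) k A j w).
  rewrite eK; apply: eq_bigr => A _.
  have [i1 e1] := @Rintegral_sum _ _ _ P _ (index_enum 'I_n)
    (fun j => j \notin A) (fun j => h A j) (ih A).
  have [i2 e2] := @Rintegral_sum _ _ _ P _ (index_enum 'I_n)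
    (fun j => j \notin A) (fun j => k A j) (ik A).
  rewrite !RintegralZl// e1 e2.
  rewrite (eq_bigr (fun j => 2 * \int[P]_w k A j w)) => [|j jA]; last exact: hk.
  by rewrite -mulr_sumr; field.
(* The prefactor 1/2 has cancelled the 2 of [hk]. The weighted increments of [f (X^A)] now telescope
   from [f X] to [f X']. *)
transitivity (\int[P]_w (g (X w) * f (X w) - g (X w) * f (X' w))).
  apply: eq_Rintegral => w _.
  rewrite -mulrBr -[X in f X - _](resample0 _ (X' w)) -[X in _ - f X](resampleT (X w)).
  rewrite -(resampling_telescope (fun A => f (resample (X w) (X' w) A))).
  rewrite mulr_sumr; apply: eq_bigr => A _.
  by rewrite [RHS]mulrA [RHS]mulrC [in RHS]mulr_sumr.
rewrite RintegralB// (integral_mul_copy copy)// ?subr0//.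
Qed.

End covariance_identity.

(** * Conditioning and the remainder *)

Section conditional_pull_out.
Context (R : realType) (dO : measure_display) (Omega : measurableType dO).
Variables (P : probability Omega R) (W D : Omega -> R).
Hypotheses (mW : measurable_fun setT W) (iD : P.-integrable setT (EFin \o D)).
Hypothesis D0 : forall B, measurable B -> \int[P]_(w in W @^-1` B) D w = 0.

Lemma integrable_bounded_mul (psi : R -> R) : measurable_fun setT psi ->
  (forall x, `|psi x| <= 1) ->
  P.-integrable setT (EFin \o (fun w => psi (W w) * D w)).
Proof.
move=> mpsi psi1; apply: (le_integrable_EFin _ (integrable_norm iD)).
  apply: measurable_funM; first exact: measurableT_comp.
  exact: integrable_measurable iD.
by move=> w /=; rewrite normrM ler_piMl.
Qed.

(* Halving: [psi = 1/2 psi' + 1/2 1_{psi >= 1/2}] with [psi'] again valued in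
   [0, 1], and the indicator integrates [D] to 0. *)
Let halving k (psi : R -> R) : measurable_fun setT psi ->
  (forall x, 0 <= psi x <= 1) ->
  `|\int[P]_w (psi (W w) * D w)| <= 2^-1 ^+ k * \int[P]_w `|D w|.
Proof.
elim: k psi => [|k IH] psi mpsi psi01.
  have psi1 x : `|psi x| <= 1 by have /andP[h1 h2] := psi01 x; rewrite ger0_norm.
  have ipsi := integrable_bounded_mul mpsi psi1.
  rewrite expr0 mul1r; apply: le_trans (le_normr_Rintegral measurableT ipsi) _.
  apply: le_Rintegral => //; [exact: integrable_norm ipsi|exact: integrable_norm iD|].
  by move=> w _; rewrite normrM ler_piMl.
pose B := [set x : R | 2^-1 <= psi x].
have mB : measurable B.
  have := mpsi measurableT `[2^-1, +oo[%classic (measurable_itv _).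
  by rewrite setTI (_ : _ @^-1` _ = B)//; apply/seteqP; split => x /=; rewrite in_itv/= andbT.
pose psi' x := 2 * psi x - \1_B x.
have mpsi' : measurable_fun setT psi'.
  by apply: measurable_funB; [exact: measurable_funM|exact: measurable_indic].
have BE x : \1_B x = (if 2^-1 <= psi x then 1 else 0) :> R.
  by rewrite indicE; case: ifPn => [?|/negP ?]; [rewrite mem_set|rewrite memNset].
have psi'01 x : 0 <= psi' x <= 1.
  by rewrite /psi' BE; have /andP[h1 h2] := psi01 x; case: (leP 2^-1) => h3; apply/andP; split; lra.
have psi'1 x : `|psi' x| <= 1 by have /andP[h1 h2] := psi'01 x; rewrite ger0_norm.
have B1 x : `|\1_B x : R| <= 1 by rewrite BE; case: ifP => _; rewrite ?normr1 ?normr0.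
have i1 := integrable_bounded_mul mpsi' psi'1.
have mB1 : measurable_fun setT (\1_B : R -> R) by exact: measurable_indic.
have i2 := integrable_bounded_mul mB1 B1.
have -> : \int[P]_w (psi (W w) * D w) =
    2^-1 * (\int[P]_w (psi' (W w) * D w) + \int[P]_w (\1_B (W w) * D w)).
  rewrite -RintegralD// -RintegralZl//; last exact: (integrableD measurableT i1 i2).
  by apply: eq_Rintegral => w _; rewrite /psi'; field.
have -> : \int[P]_w (\1_B (W w) * D w) = 0.
  rewrite -[RHS](D0 mB) [RHS]Rintegral_mkcond; apply: eq_Rintegral => w _.
  rewrite patchE indicE.
  by rewrite (_ : (W w \in B) = (w \in W @^-1` B))// mulr_natl; case: (w \in _).
rewrite addr0 normrM ger0_norm ?invr_ge0// exprS -mulrA ler_wpM2l ?invr_ge0//.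
exact: IH.
Qed.

(** Applied to [D = T - Z] with [Z] a version of [E (T | W)], this replaces [T] by [Z] next to a
    bounded function of [W]. Iterated halving bounds the integral by arbitrarily small multiples of
    [E |D|]. *)
Lemma integral_pull_out (psi : R -> R) : measurable_fun setT psi ->
  (forall x, `|psi x| <= 1) -> \int[P]_w (psi (W w) * D w) = 0.
Proof.
move=> mpsi psi1.
have DT : \int[P]_w D w = 0 by rewrite -[RHS](D0 measurableT) preimage_setT.
have vanish (r : R -> R) : measurable_fun setT r -> (forall x, 0 <= r x <= 1) ->
    \int[P]_w (r (W w) * D w) = 0.
  move=> mr r01; apply/eqP; rewrite -normr_eq0 -[_ == _]negbK; apply/negP => n0.
  have a0 : 0 < `|\int[P]_w (r (W w) * D w)| by rewrite lt_def n0 normr_ge0.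
  set a := `| _ | in a0 n0; pose C := \int[P]_w `|D w|.
  (* With this [k], [C < (k + 1) * a <= 2 ^ (k + 1) * a], contrary to the halving bound at
     [k.+1]. *)
  pose k := Num.truncn (C / a).
  have : C / a < k.+1%:R by rewrite truncnS_gt.
  rewrite ltr_pdivrMr// => Cka.
  have := halving k.+1 mr r01; rewrite -/a -/C exprVn.
  rewrite mulrC ler_pdivlMr ?exprn_gt0// leNgt => /negP; apply.
  apply: lt_le_trans Cka _; rewrite mulrC ler_wpM2l ?(ltW a0)//.
  by rewrite -natrX ler_nat ltnW// ltn_expl.
(* Affine rescaling from [-1, 1] to [0, 1]; the constant drops out because [D] integrates to 0. *)
pose r x := (psi x + 1) / 2.
have mr : measurable_fun setT r.
  by apply: measurable_funM => //; exact: measurable_funD.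
have r01 x : 0 <= r x <= 1.
  by have := psi1 x; rewrite ler_norml /r => /andP[h1 h2]; apply/andP; split; lra.
have r1 x : `|r x| <= 1 by have /andP[h1 h2] := r01 x; rewrite ger0_norm.
have ir := integrable_bounded_mul mr r1.
transitivity (\int[P]_w (2 * (r (W w) * D w) - D w)).
  by apply: eq_Rintegral => w _; rewrite /r; field.
rewrite RintegralB//; last exact: (integrableZl measurableT 2 ir).
by rewrite RintegralZl// vanish// DT mulr0 subr0.
Qed.

End conditional_pull_out.

Section second_moment_bound.
Context (R : realType) (dO : measure_display) (Omega : measurableType dO).
Variable P : probability Omega R.

Lemma square_integrable_cst (a : R) : square_integrable P (fun=> a).
Proof. by split => //; exact: finite_measure_integrable_cst. Qed.

Lemma square_integrable_integrable (Y : Omega -> R) : square_integrable P Y ->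
  P.-integrable setT (EFin \o Y).
Proof.
move=> sY; have := square_integrableM (square_integrable_cst 1) sY.
by under eq_fun do rewrite mul1r.
Qed.

(** Expand [0 <= E (|Y| - m) ^+ 2] with [m = E |Y|]. *)
Lemma sqr_Rintegral_norm_le (Y : Omega -> R) : square_integrable P Y ->
  (\int[P]_w `|Y w|) ^+ 2 <= \int[P]_w (Y w ^+ 2).
Proof.
move=> sY; have iY := integrable_norm (square_integrable_integrable sY).
set m := Rintegral _ _ _.
have iY2 := sY.2.
have im : P.-integrable setT (EFin \o (fun w => 2 * m * `|Y w|)).
  exact: (integrableZl measurableT (2 * m) iY).
have ic : P.-integrable setT (EFin \o (fun _ : Omega => m ^+ 2)).
  exact: finite_measure_integrable_cst.
have : 0 <= \int[P]_w ((Y w ^+ 2 - 2 * m * `|Y w|) + m ^+ 2).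
  apply: Rintegral_ge0 => w _.
  rewrite -(real_normK (num_real (Y w))).
  by have := sqr_ge0 (`|Y w| - m); nra.
rewrite RintegralD//; last exact: (integrableB measurableT iY2 im).
rewrite RintegralB// RintegralZl// Rintegral_cst// -/m.
have -> : fine (P [set: Omega]) = 1 by rewrite probability_setT.
by rewrite mulr1; nra.
Qed.

End second_moment_bound.

(** * The third-moment remainder *)

Section remainder.
Context (R : realType) (dS : measure_display) (S : measurableType dS) (n : nat).
Context (dO : measure_display) (Omega : measurableType dO).
Variables (P : probability Omega R) (X X' : {RV P >-> n.-tuple S}).
Local Notation V := (n.-tuple S).
Local Notation wt := (@resampling_weight R n).
Hypothesis indep : mutually_independent P (fun (i : 'I_n) w => tnth (X w) i).
Hypothesis copy : independent_copy X X'.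

(** Young's inequality with exponents 3/2 and 3. It serves instead of Hölder's inequality, since the
    two cubes it is applied to have equal means. *)
Lemma young_cube (a b : R) : 0 <= a -> 0 <= b ->
  a ^+ 2 * b <= (2 * a ^+ 3 + b ^+ 3) / 3.
Proof.
move=> a0 b0; rewrite -subr_ge0.
rewrite (_ : _ - _ = (a - b) ^+ 2 * (2 * a + b) / 3); last by field.
by rewrite divr_ge0// mulr_ge0 ?sqr_ge0// addr_ge0// mulr_ge0.
Qed.

Definition cube_majorant (f : V -> R) (x x' : V) : R :=
  \sum_(A : {set 'I_n} | A \proper [set: 'I_n]%SET) wt A *
    \sum_(j < n | j \notin A)
      (2 * `|Delta f x x' j| ^+ 3 + `|DeltaA f x x' A j| ^+ 3) / 3.

(** To first order [Delta_j] of [phi (f / s)] is [s^-1 * psi (f x / s) * Delta_j f], with error at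
    most [s ^- 2 * (Delta_j f) ^+ 2]. Multiplied by [DeltaA], the error is bounded by
    [young_cube]. *)
Lemma cov_stat_taylor (f : V -> R) (phi psi : R -> R) (s : R) (x x' : V) : 0 < s ->
  (forall a b, `|phi b - phi a - psi a * (b - a)| <= (b - a) ^+ 2) ->
  `|cov_stat (fun y => phi (f y / s)) f x x' - s^-1 * psi (f x / s) * Tstat f x x'|
    <= (2 * s ^+ 2)^-1 * cube_majorant f x x'.
Proof.
move=> s0 taylor; set a := f x / s.
have -> : cov_stat (fun y => phi (f y / s)) f x x' - s^-1 * psi a * Tstat f x x' =
   2^-1 * \sum_(A : {set 'I_n} | A \proper [set: 'I_n]%SET) wt A *
     \sum_(j < n | j \notin A)
       (Delta (fun y => phi (f y / s)) x x' j - s^-1 * psi a * Delta f x x' j) *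
       DeltaA f x x' A j.
  rewrite /cov_stat /Tstat mulrCA -mulrBr; congr (_ * _).
  rewrite mulr_sumr -sumrB; apply: eq_bigr => A _.
  rewrite mulrA -mulrBl [RHS]mulrC; congr (_ * _).
  rewrite /T_ mulr_sumr -sumrB; apply: eq_bigr => j _; ring.
rewrite normrM ger0_norm ?invr_ge0// invfM -mulrA ler_wpM2l ?invr_ge0//.
rewrite /cube_majorant mulr_sumr; apply: le_trans (ler_norm_sum _ _ _) _.
apply: ler_sum => A _; rewrite normrM ger0_norm ?resampling_weight_ge0//.
rewrite mulrCA ler_wpM2l ?resampling_weight_ge0// mulr_sumr.
apply: le_trans (ler_norm_sum _ _ _) _; apply: ler_sum => j _.
rewrite normrM; set d := Delta f x x' j; set b := f (resample x x' [set j]%SET) / s.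
have dE : d = - s * (b - a) by rewrite /d /b /a /Delta; field; rewrite gt_eqF.
have h : `|Delta (fun y => phi (f y / s)) x x' j - s^-1 * psi a * d| <= s ^- 2 * `|d| ^+ 2.
  rewrite real_normK ?num_real// {2}dE exprMn sqrrN mulrA mulVf ?mul1r; last first.
    by rewrite gt_eqF// exprn_gt0.
  rewrite -normrN.
  rewrite [X in `|X|](_ : _ = phi b - phi a - psi a * (b - a)); first exact: taylor.
  by rewrite dE /Delta -/a -/b; field; rewrite gt_eqF.
apply: le_trans (ler_wpM2r (normr_ge0 _) h) _.
by rewrite -mulrA ler_wpM2l ?young_cube// invr_ge0 exprn_ge0// ltW.
Qed.

Variable f : V -> R.
Hypothesis mf : measurable_fun setT f.
Hypothesis third : forall j,
  P.-integrable setT (EFin \o (fun w => `|Delta f (X w) (X' w) j| ^+ 3)).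

(** [DeltaA] is [Delta] evaluated at the pair exchanged on [A], which has the same law as
    [(X, X')]. *)
Lemma third_moment_DeltaA (A : {set 'I_n}) (j : 'I_n) : j \notin A ->
  P.-integrable setT (EFin \o (fun w => `|DeltaA f (X w) (X' w) A j| ^+ 3)) /\
  \int[P]_w (`|DeltaA f (X w) (X' w) A j| ^+ 3) =
  \int[P]_w (`|Delta f (X w) (X' w) j| ^+ 3).
Proof.
move=> jA; pose F (z : V * V) := `|Delta f z.1 z.2 j| ^+ 3.
have mF : measurable_fun setT F.
  apply: measurable_funX; apply: measurableT_comp => //.
  by apply: measurable_funB; apply: measurableT_comp => //; exact: measurable_resample.
have E w : `|DeltaA f (X w) (X' w) A j| ^+ 3 = F (swap_resample X X' A w).
  rewrite /F /swap_resample /Delta /DeltaA/= resample_resample.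
  congr (`| f _ - f (resample _ _ _) | ^+ 3).
  apply/finset.setP => i; rewrite !finset.inE.
  by have [->|_] := eqVneq i j; rewrite ?(negPf jA)//=; case: (i \in A).
split; first by under eq_fun do rewrite E; exact: (integrable_swap indep copy A mF (third j)).
under eq_Rintegral do rewrite E.
exact: (Rintegral_swap indep copy A mF).
Qed.

(** Both cubes for [j] have the same mean, so the average (2 + 1) / 3 returns it, and the weights of
    the sets avoiding [j] sum to 1. *)
Lemma integral_cube_majorant :
  P.-integrable setT (EFin \o (fun w => cube_majorant f (X w) (X' w))) /\
  \int[P]_w cube_majorant f (X w) (X' w) =
  \sum_(j < n) \int[P]_w (`|Delta f (X w) (X' w) j| ^+ 3).
Proof.
pose b j := \int[P]_w (`|Delta f (X w) (X' w) j| ^+ 3).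
(* The default 0 makes [h A j] integrable for every index, as [Rintegral_sum] asks. *)
pose h (A : {set 'I_n}) j w := if j \notin A then
  (2 * `|Delta f (X w) (X' w) j| ^+ 3 + `|DeltaA f (X w) (X' w) A j| ^+ 3) / 3 else 0.
have ih A j : P.-integrable setT (EFin \o (h A j)).
  rewrite /h; case: (boolP (j \notin A)) => jA; last exact: integrable0.
  have [iA _] := third_moment_DeltaA jA.
  have i2 := integrableZl measurableT 2 (third j).
  exact: (integrableZr measurableT 3^-1 (integrableD measurableT i2 iA)).
have eh (A : {set 'I_n}) j : j \notin A -> \int[P]_w h A j w = b j.
  move=> jA; rewrite /h jA; have [iA eA] := third_moment_DeltaA jA.
  have i2 := integrableZl measurableT 2 (third j).
  rewrite RintegralZr//; last exact: (integrableD measurableT i2 iA).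
  by rewrite RintegralD// RintegralZl// eA -/(b j); field.
have iA (A : {set 'I_n}) := @Rintegral_sum _ _ _ P _ (index_enum 'I_n)
  (fun j => j \notin A) (fun j => h A j) (ih A).
have [] := @Rintegral_sum _ _ _ P _ (index_enum {set 'I_n})
  (fun A => A \proper [set: 'I_n]%SET)
  (fun A w => wt A * \sum_(j < n | j \notin A) h A j w).
  by move=> A; exact: (integrableZl measurableT (wt A) (iA A).1).
have E w : cube_majorant f (X w) (X' w) =
    \sum_(A : {set 'I_n} | A \proper [set: 'I_n]%SET)
      wt A * \sum_(j < n | j \notin A) h A j w.
  apply: eq_bigr => A _; congr (_ * _).
  by apply: eq_bigr => j jA; rewrite /h jA.
move=> iM eM; split; first by under eq_fun do rewrite E.
under eq_Rintegral do rewrite E.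
rewrite eM -[RHS]/(\sum_(j < n) b j).
transitivity (\sum_(A : {set 'I_n} | A \proper [set: 'I_n]%SET)
    \sum_(j < n | j \notin A) wt A * b j).
  apply: eq_bigr => A _; rewrite RintegralZl//; last exact: (iA A).1.
  rewrite (iA A).2 mulr_sumr; apply: eq_bigr => j jA; by rewrite eh.
rewrite (exchange_big_dep predT)//=; apply: eq_bigr => j _.
by rewrite -mulr_suml sum_resampling_weight mul1r.
Qed.

End remainder.

(** * The normal approximation bound *)

Section stein_resampling.
Context (R : realType) (dS : measure_display) (S : measurableType dS) (n : nat).
Context (dO : measure_display) (Omega : measurableType dO).
Variables (P : probability Omega R) (X X' : {RV P >-> n.-tuple S}).
Local Notation V := (n.-tuple S).
Hypothesis indep : mutually_independent P (fun (i : 'I_n) w => tnth (X w) i).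
Hypothesis copy : independent_copy X X'.
Variables (f : V -> R) (s : R) (Z : Omega -> R).
Hypotheses (mf : measurable_fun setT f) (s0 : 0 < s).
Hypothesis sf : square_integrable P (fun w => f (X w)).
Hypothesis f0 : \int[P]_w f (X w) = 0.
Hypothesis third : forall j,
  P.-integrable setT (EFin \o (fun w => `|Delta f (X w) (X' w) j| ^+ 3)).
Hypothesis sZ : square_integrable P (fun w => Z w - s ^+ 2).
Let T w := Tstat f (X w) (X' w).
Hypothesis condZ : forall B : set R, measurable B ->
  \int[P]_(w in (f \o X) @^-1` B) (T w - Z w) = 0.

Let mW : measurable_fun setT (f \o X).
Proof. exact: measurableT_comp. Qed.

Let iT : P.-integrable setT (EFin \o T).
Proof. by have [] := integral_cov_stat indep copy mf mf sf sf f0. Qed.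

Let iZ : P.-integrable setT (EFin \o Z).
Proof.
have := integrableD measurableT (square_integrable_integrable sZ)
  (square_integrable_integrable (square_integrable_cst P (s ^+ 2))).
by apply: eq_integrable => // w _ /=; rewrite -EFinD subrK.
Qed.

Lemma stein_resampling_bound (h : R -> R) : (forall x y, `|h x - h y| <= `|x - y|) ->
  exists c : R,
  [/\ (\int[normal_prob 0 1]_y (h y)%:E = c%:E)%E,
      P.-integrable setT (EFin \o (fun w => h (f (X w) / s))) &
      `|\int[P]_w h (f (X w) / s) - c| <=
      Num.sqrt (\int[P]_w (Z w - s ^+ 2) ^+ 2) / s ^+ 2 + (2 * s ^+ 3)^-1 *
        \sum_(j < n) \int[P]_w (`|Delta f (X w) (X' w) j| ^+ 3)].
Proof.
move=> lip; have [phi [psi [hE cpsi psi1 philip taylor]]] := stein_equation lip.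
(* By Stein's equation [h x - (psi x - x * phi x)] is the normal mean of [h] for every [x]; it is
   named by its value at 0. *)
pose c := h 0 - (psi 0 - 0 * phi 0).
have cE x : h x = c + (psi x - x * phi x).
  by have := hE x; rewrite (hE 0) => -[]; rewrite /c; lra.
have mpsi : measurable_fun setT psi by exact: continuous_measurable_fun.
have mphi : measurable_fun setT phi.
  by apply: continuous_measurable_fun; exact: lip_continuous philip.
have mdiv : measurable_fun setT (fun x : R => x / s) by exact: measurable_funM.
pose r x := psi (x / s).
have mr : measurable_fun setT r by exact: measurableT_comp.
have r1 x : `|r x| <= 1 by exact: psi1.
pose g (y : V) := phi (f y / s).
have mg : measurable_fun setT g.
  exact: (measurableT_comp mphi (measurableT_comp mdiv mf)).
have sg : square_integrable P (fun w => g (X w)).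
  split; first exact: measurableT_comp.
  have i2 := integrableZl measurableT (2 / s ^+ 2) sf.2.
  (* The majorant is [2 * (W / s) ^+ 2 + 2 * phi 0 ^+ 2], as [phi] is 1-Lipschitz; the square root
     is there because the constant gets squared. *)
  have i1 := (square_integrable_cst P (Num.sqrt (2 * phi 0 ^+ 2))).2.
  apply: (le_integrable_EFin _ (integrableD measurableT i2 i1)).
    by apply: measurable_funX; exact: measurableT_comp.
  move=> w; rewrite ger0_norm ?sqr_ge0// sqr_sqrtr; last by rewrite mulr_ge0 ?(sqr_ge0 (phi 0)).
  have := philip (f (X w) / s) 0; rewrite subr0 -/(g (X w)) => le1.
  have le2 : (g (X w) - phi 0) ^+ 2 <= (f (X w) / s) ^+ 2.
    rewrite -real_normK ?num_real// -[leRHS]real_normK ?num_real//.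
    by rewrite ler_pXn2r ?nnegrE.
  rewrite (_ : 2 / s ^+ 2 * _ = 2 * (f (X w) / s) ^+ 2); last by field; rewrite gt_eqF.
  by have := sqr_ge0 (g (X w) - 2 * phi 0); move: le2; nra.
have [icov ecov] := integral_cov_stat indep copy mg mf sg sf f0.
have irT := integrable_bounded_mul mW iT mr r1.
have irZ := integrable_bounded_mul mW iZ mr r1.
have igf := square_integrableM sg sf.
have s1 := square_integrable_integrable (square_integrable_cst P 1).
have ir1 := integrable_bounded_mul mW s1 mr r1.
have ir : P.-integrable setT (EFin \o (fun w => r (f (X w)))).
  by move: ir1; under eq_fun do rewrite mulr1.
have pull : \int[P]_w (r (f (X w)) * T w) = \int[P]_w (r (f (X w)) * Z w).
  have iTZ : P.-integrable setT (EFin \o (fun w => T w - Z w)).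
    exact: (integrableB measurableT iT iZ).
  have := integral_pull_out mW iTZ condZ mr r1.
  under eq_Rintegral do rewrite mulrBr.
  by rewrite RintegralB// => /eqP; rewrite subr_eq0 => /eqP.
have hXE w : h (f (X w) / s) = c + (r (f (X w)) - s^-1 * (g (X w) * f (X w))).
  by rewrite cE /r /g; ring.
have igs := integrableZl measurableT s^-1 igf.
have ich := square_integrable_integrable (square_integrable_cst P c).
have irg : P.-integrable setT (EFin \o (fun w => r (f (X w)) - s^-1 * (g (X w) * f (X w)))).
  exact: (integrableB measurableT ir igs).
have ihX := integrableD measurableT ich irg.
have [iM eM] := integral_cube_majorant indep copy mf third.
exists c; split; first exact: hE.
  by under eq_fun do rewrite hXE.
(* Stein's equation and the covariance identity give [E psi - s^-1 * E (cov_stat g f)]. Adding and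
   subtracting [s ^- 2 * E (psi * T)], with [T] replaced by [Z] once, separates the fluctuation of
   [Z] about [s ^+ 2] from the Taylor remainder. *)
have -> : \int[P]_w h (f (X w) / s) - c =
    s ^- 2 * \int[P]_w (r (f (X w)) * (s ^+ 2 - Z w)) -
    s^-1 * \int[P]_w (cov_stat g f (X w) (X' w) - s^-1 * (r (f (X w)) * T w)).
  under eq_Rintegral do rewrite hXE.
  rewrite RintegralD// Rintegral_cst// RintegralB// RintegralZl//.
  rewrite (RintegralB measurableT icov (integrableZl measurableT s^-1 irT)).
  rewrite (RintegralZl s^-1 measurableT irT).
  rewrite ecov pull.
  transitivity (\int[P]_w r (f (X w)) - s^-1 * \int[P]_w (g (X w) * f (X w))).
    have -> : fine (P setT) = 1 by rewrite probability_setT.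
    ring.
  have -> : \int[P]_w (r (f (X w)) * (s ^+ 2 - Z w)) =
      s ^+ 2 * \int[P]_w r (f (X w)) - \int[P]_w (r (f (X w)) * Z w).
    rewrite -RintegralZl// -RintegralB//; last exact: (integrableZl measurableT (s ^+ 2) ir).
    by apply: eq_Rintegral => w _; ring.
  by field; rewrite gt_eqF.
apply: le_trans (ler_normB _ _) _; apply: lerD.
  rewrite normrM ger0_norm ?invr_ge0 ?exprn_ge0 ?(ltW s0)// mulrC.
  rewrite ler_wpM2r ?invr_ge0 ?exprn_ge0 ?(ltW s0)//.
  have iY := square_integrable_integrable sZ.
  have irY := integrable_bounded_mul mW iY mr r1.
  have -> : \int[P]_w (r (f (X w)) * (s ^+ 2 - Z w)) =
    - \int[P]_w (r (f (X w)) * (Z w - s ^+ 2)).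
    by rewrite -mulN1r -RintegralZl//; apply: eq_Rintegral => w _; ring.
  rewrite normrN; apply: le_trans (le_normr_Rintegral measurableT irY) _.
  apply: (@le_trans _ _ (\int[P]_w `|Z w - s ^+ 2|)).
    apply: le_Rintegral => //; [exact: integrable_norm irY|exact: integrable_norm iY|].
    by move=> w _; rewrite normrM ler_piMl.
  rewrite -[leLHS]ger0_norm ?Rintegral_ge0// -sqrtr_sqr ler_wsqrtr//.
  exact: sqr_Rintegral_norm_le.
rewrite normrM ger0_norm ?invr_ge0 ?(ltW s0)// -eM.
rewrite (_ : (2 * s ^+ 3)^-1 * _ = s^-1 * ((2 * s ^+ 2)^-1 *
    \int[P]_w cube_majorant f (X w) (X' w))); last by field; rewrite gt_eqF.
rewrite ler_wpM2l ?invr_ge0 ?(ltW s0)//.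
have ierr : P.-integrable setT (EFin \o (fun w =>
    cov_stat g f (X w) (X' w) - s^-1 * (r (f (X w)) * T w))).
  exact: (integrableB measurableT icov (integrableZl measurableT s^-1 irT)).
apply: le_trans (le_normr_Rintegral measurableT ierr) _.
rewrite -RintegralZl//; apply: le_Rintegral => //.
- exact: integrable_norm ierr.
- exact: (integrableZl measurableT _ iM).
- move=> w _; rewrite mulrA; exact: cov_stat_taylor.
Qed.

End stein_resampling.

Lemma variance_integral (R : realType) (dO : measure_display)
    (Omega : measurableType dO) (P : probability Omega R) (Y : Omega -> R) (m : R) :
  (\int[P]_w (Y w)%:E = m%:E)%E ->
  ('V_P[Y] = \int[P]_w ((Y w - m) ^+ 2)%:E)%E.
Proof.
move=> Ym; rewrite /variance (unlock covariance_unlockable) (unlock expectation_unlockable) Ym.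
by apply: eq_integral => w _; rewrite expr2.
Qed.

Theorem theorem2p2 (R : realType)
    (dS : measure_display) (S : measurableType dS)
    (dO : measure_display) (Omega : measurableType dO)
    (P : probability Omega R) (n : nat)
    (X X' : {RV P >-> n.-tuple S}) (f : {mfun n.-tuple S >-> R})
    (sigma : R) :
  (1 <= n)%N ->
  mutually_independent P (fun (i : 'I_n) w => tnth (X w) i) ->
  independent_copy X X' ->
  let W : {RV P >-> R} := f \o X in
  let T : Omega -> R := fun w => Tstat f (X w) (X' w) in
  ('E_P[W] = 0)%E ->
  0 < sigma ->
  ('E_P[fun w => (W w ^+ 2)%R] = (sigma ^+ 2)%:E)%E ->
  ('E_P[T] = (sigma ^+ 2)%:E)%E /\
  forall Z : Omega -> R, is_cond_expectation P T W Z ->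
    (normality_distance W <=
       sqrte 'V_P[Z] / (sigma ^+ 2)%:E +
       (2 * sigma ^+ 3)^-1%:E *
         \sum_(j < n) 'E_P[fun w => (`|Delta f (X w) (X' w) j| ^+ 3)%R])%E.
Proof.
move=> _ indep copy W T; rewrite unlock => EW s0 EW2.
have mf : measurable_fun setT f by [].
have mW : measurable_fun setT (fun w => f (X w)) by exact: measurableT_comp.
have sf : square_integrable P (fun w => f (X w)).
  split=> //; apply/integrableP; split.
    by apply/measurable_EFinP; exact: measurable_funX.
  under eq_integral do rewrite /= ger0_norm ?sqr_ge0//.
  by rewrite -[X in (X < _)%E]/(\int[P]_w (W w ^+ 2)%:E)%E EW2 ltry.
have f0 : \int[P]_w f (X w) = 0 by rewrite /Rintegral -[X in fine X]/(\int[P]_w (W w)%:E)%E EW.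
have [iT eT] := integral_cov_stat indep copy mf mf sf sf f0.
have ET : (\int[P]_w (T w)%:E)%E = (sigma ^+ 2)%:E.
  rewrite -[LHS]fineK; last exact: integrable_fin_num.
  rewrite -[fine _]/(\int[P]_w T w) eT; congr EFin.
  under eq_Rintegral do rewrite -expr2.
  by rewrite /Rintegral -[X in fine X]/(\int[P]_w (W w ^+ 2)%:E)%E EW2.
split=> // Z [iZ _ cZ].
have EZ : (\int[P]_w (Z w)%:E)%E = (sigma ^+ 2)%:E.
  rewrite cZ ?ET//; exists setT => //.
  by rewrite setTI preimage_setT.
have VZ := variance_integral EZ.
(* The mean is 0 and the variance [sigma ^+ 2], so standardizing is division by [sigma]. *)
have stdE : standardize W = fun w => f (X w) / sigma.
  apply/funext => w; rewrite /standardize (unlock expectation_unlockable) EW subr0.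
  rewrite (variance_integral EW) (_ : (\int[P]__ _)%E = (sigma ^+ 2)%:E).
    by rewrite /= sqrtr_sqr gtr0_norm.
  by rewrite -EW2; apply: eq_integral => w' _; rewrite subr0.
have b0 j : (0 <= \int[P]_w (`|Delta f (X w) (X' w) j| ^+ 3)%:E)%E.
  by apply: integral_ge0 => w _; rewrite lee_fin exprn_ge0.
have s2 : 0 < sigma ^+ 2 by rewrite exprn_gt0.
have s3 : 0 < (2 * sigma ^+ 3)^-1 by rewrite invr_gt0 mulr_gt0// exprn_gt0.
have V0 : (0 <= sqrte 'V_P[Z] / (sigma ^+ 2)%:E)%E.
  by rewrite mule_ge0 ?sqrte_ge0// inver gt_eqF// lee_fin invr_ge0 ltW.
have mDelta j : measurable_fun setT (fun w => `|Delta f (X w) (X' w) j| ^+ 3).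
  apply: measurable_funX; apply: measurableT_comp => //.
  by apply: measurable_funB => //; apply: measurableT_comp => //; exact: measurable_resample.
(* If the third moments or, further down, the variance of [Z] are infinite, the right-hand side is
   [+oo]: the coefficients are positive and the other term is not [-oo]. *)
have [Soo|Sfin] := eqVneq (\sum_(j < n) \int[P]_w (`|Delta f (X w) (X' w) j| ^+ 3)%:E)%E +oo%E.
  by rewrite Soo gt0_muley ?lte_fin// addey ?leey// gt_eqF// (lt_le_trans _ V0).
have third j : P.-integrable setT (EFin \o (fun w => `|Delta f (X w) (X' w) j| ^+ 3)).
  apply/integrableP; split; first exact/measurable_EFinP.
  under eq_integral do rewrite /= ger0_norm ?exprn_ge0//.
  rewrite ltey; apply: contra Sfin => /eqP joo.
  rewrite (bigD1 j)//= joo addye// gt_eqF// (@lt_le_trans _ _ 0%E)//.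
  exact: sume_ge0.
have SE : (\sum_(j < n) \int[P]_w (`|Delta f (X w) (X' w) j| ^+ 3)%:E)%E =
    (\sum_(j < n) \int[P]_w (`|Delta f (X w) (X' w) j| ^+ 3))%:E.
  rewrite -sumEFin; apply: eq_bigr => j _; rewrite /Rintegral fineK//.
  exact: integrable_fin_num (third j).
rewrite SE.
have [Voo|Vfin] := eqVneq 'V_P[Z]%E +oo%E.
  by rewrite Voo/= inver gt_eqF// gt0_mulye ?lte_fin ?invr_gt0// addye ?leey.
have sZ : square_integrable P (fun w => Z w - sigma ^+ 2).
  split; first by apply: measurable_funB => //; exact: integrable_measurable iZ.
  apply/integrableP; split.
    apply/measurable_EFinP; apply: measurable_funX; apply: measurable_funB => //.
    exact: integrable_measurable iZ.
  under eq_integral do rewrite /= ger0_norm ?sqr_ge0//.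
  by rewrite -VZ ltey.
have VE : 'V_P[Z]%E = (\int[P]_w (Z w - sigma ^+ 2) ^+ 2)%:E.
  by rewrite VZ /Rintegral fineK//; exact: integrable_fin_num sZ.2.
have condZ B : measurable B -> \int[P]_(w in (f \o X) @^-1` B) (T w - Z w) = 0.
  move=> mB; have mWB : measurable ((f \o X) @^-1` B).
    by rewrite -[X in measurable X]setTI; exact: mW.
  (* Preimages of Borel sets under [W] are the sets on which [Z] and [T] have equal integrals. *)
  rewrite RintegralB//; try exact: integrableS iT; try exact: integrableS iZ.
  by rewrite /Rintegral cZ ?subrr//; exists B => //; rewrite setTI.
apply: ge_ereal_sup => _ [h lip <-].
have lip' x y : `|h x - h y| <= `|x - y|.
  by have := lip (x, y); rewrite /= mul1r; apply.
have [c [hc ih bound]] := stein_resampling_bound indep copy mf s0 sf f0 third sZ condZ lip'.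
have mh : measurable_fun setT h.
  by apply: continuous_measurable_fun; exact: lip_continuous lip'.
have hWE : (\int[distribution P (standardize W)]_x (h x)%:E =
    (\int[P]_w h (f (X w) / sigma))%:E)%E.
  have stdhE : (fun x : measurableTypeR R => (h x)%:E) \o standardize W =
      EFin \o (fun w => h (f (X w) / sigma)).
    by apply/funext => w /=; rewrite stdE.
  have mEh : measurable_fun setT (fun x : measurableTypeR R => (h x)%:E).
    exact/measurable_EFinP.
  rewrite (integral_distribution mEh) stdhE//.
  by rewrite /Rintegral fineK//; exact: (integrable_fin_num measurableT ih).
by rewrite hWE hc VE/= inver gt_eqF.
Qed.
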